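(* Fix an integer $n \geq 3$ and real numbers $0<s_n<\cdots<s_2<s_1<\infty$. Let $\mu$ be the uniform probability measure on $S=\{s_n,\dots,s_1\}$. In the $(S,\mu)$-bullet process with bullets $b_1,b_2,\dots$ the following hold. (i) The second fastest bullet survives with positive probability: $\mathbf{P}[b_1 \text{ survives}\mid s(b_1)=s_2]>0$. (ii) The slowest bullet perishes almost surely: $\mathbf{P}[b_1 \text{ survives}\mid s(b_1)=s_n]=0$.
   Context: $(S,\mu)$-bullet process: $S\subseteq(0,\infty)$ is a set of speeds and $\mu$ a probability measure on $S$. Bullets $b_1,b_2,\dots$ are fired from the origin along the positive real line, with $b_i$ fired at time $i$. The speed of $b_i$ is $s(b_i)$, and the speeds are i.i.d. with law $\mu$. As long as it has not been annihilated, $b_i$ is at position $s(b_i)(t-i)$ at time $t\ge i$. When two or more bullets collide (are at the same position at the same time), all of them are annihilated (removed). For $i>j$ write $b_i\mapsto b_j$ (''$b_i$ catches $b_j$'') for the event that $b_i$ and $b_j$ collide, with $b_i$ the faster one, resulting in their mutual annihilation. Let $\tilde\tau$ be the minimum index with $b_{\tilde\tau}\mapsto b_1$, with $\tilde\tau=\infty$ if $b_1$ is never caught. We say $b_1$ survives if $\tilde\tau=\infty$ and perishes if $\tilde\tau<\infty$. *)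

(* Defs.v *)
From HB Require Import structures.
From mathcomp Require Import all_boot all_order all_algebra.
From mathcomp Require Import finmap lra.
From mathcomp Require Import all_classical all_reals all_analysis.
Set Implicit Arguments.
Unset Strict Implicit.
Unset Printing Implicit Defensive.
Import Order.TTheory GRing.Theory Num.Theory.
Local Open Scope classical_set_scope.
Local Open Scope ring_scope.

(** Bullets are numbered from 1, as usual: [b_i] is the index [i >= 1], fired
    from the origin at time [i].  Index 0 denotes no bullet, and the value at 0
    of a speed sequence [v : nat -> R] is irrelevant. *)

Definition bullet_pos (R : realType) (v : nat -> R) (i : nat) (t : R) : R :=
  v i * (t - i%:R).

(** [alive i t] reads "[b_i] has been fired by time [t] and was not annihilated
    at any time strictly before [t]"; thus a bullet annihilated at time [t] is
    still alive at [t], and [collide alive i j t] says that [b_i] and [b_j] both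
    reach time [t] and are at the same position at that time. *)
Definition collide (R : realType) (v : nat -> R) (alive : nat -> R -> Prop)
    (i j : nat) (t : R) : Prop :=
  [/\ i <> j, alive i t, alive j t & bullet_pos v i t = bullet_pos v j t].

(** All the bullets involved in a (possibly multiple) collision are removed.
    For positive speeds this equation has exactly one solution, see
    [bullet_dynamics_exists] and [bullet_dynamics_unique] below. *)
Definition bullet_dynamics (R : realType) (v : nat -> R)
    (alive : nat -> R -> Prop) : Prop :=
  forall i t, alive i t <->
    [/\ (0 < i)%N, i%:R <= t & forall u j, u < t -> ~ collide v alive i j u].

Definition catches (R : realType) (v : nat -> R) (alive : nat -> R -> Prop)
    (i j : nat) : Prop :=
  [/\ (j < i)%N, v j < v i & exists t, collide v alive i j t].

(** The infimum of a set of indices is its minimum, and it is [+oo] if the set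
    is empty. *)
Definition catch_index (R : realType) (v : nat -> R)
    (alive : nat -> R -> Prop) : \bar R :=
  ereal_inf [set (i%:R)%:E | i in [set i : nat | catches v alive i 1]].

Definition b1_survives (R : realType) (v : nat -> R)
    (alive : nat -> R -> Prop) : Prop :=
  catch_index v alive = +oo%E.

Definition mutually_independent (d : measure_display) (T : measurableType d)
    (R : realType) (P : probability T R) (I : set nat)
    (X : nat -> {RV P >-> R}) : Prop :=
  forall (J : {fset nat}) (A : nat -> set R),
    [set` J] `<=` I -> (forall i, i \in J -> measurable (A i)) ->
    P (\bigcap_(i in [set` J]) (X i @^-1` A i)) =
    (\prod_(i <- J) P (X i @^-1` A i))%E.

(** [X i w] is the speed of [b_i], and [alive w] the trajectories, in the
    outcome [w]. *)
Definition bullet_process (R : realType) (S : set R)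
    (mu : {measure set R -> \bar R}) (d : measure_display)
    (T : measurableType d) (P : probability T R) (X : nat -> {RV P >-> R})
    (alive : T -> nat -> R -> Prop) : Prop :=
  [/\ forall i w, (0 < i)%N -> S (X i w),
      forall i A, (0 < i)%N -> measurable A -> distribution P (X i) A = mu A,
      mutually_independent [set i | (0 < i)%N] X
    & forall w, bullet_dynamics (fun i => X i w) (alive w)].

Definition speed_set (R : realType) (n : nat) (s : nat -> R) : set R :=
  [set s k | k in [set k | (1 <= k <= n)%N]].

(** The uniform probability measure on [speed_set n s], when [0 < n] and
    [s 1, ..., s n] are pairwise distinct. *)
Definition uniform_law (R : realType) (n : nat) (s : nat -> R) :
    {measure set R -> \bar R} :=
  mscale (n%:R^-1)%:nng (msum (fun k => \d_(s k.+1)) n).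

Definition cond_prob (d : measure_display) (T : measurableType d)
    (R : realType) (P : probability T R) (A B : set T) : R :=
  fine (P (A `&` B)) / fine (P B).

Section dynamics_well_posed.
Variables (R : realType) (v : nat -> R).
Hypothesis v_gt0 : forall i, (0 < i)%N -> 0 < v i.

Let meet (i j : nat) (u : R) : Prop :=
  [/\ (0 < i)%N, i <> j, i%:R <= u, j%:R <= u
    & bullet_pos v i u = bullet_pos v j u].

Let before (u t : R) : Prop := u < t /\ exists i j, meet i j u.

Let meet_time (i j : nat) (u : R) : meet i j u ->
  u = (v i * i%:R - v j * j%:R) / (v i - v j).
Proof.
move=> [i0 ij _ _]; rewrite /bullet_pos => E.
have vij : v i - v j != 0.
  apply/eqP => /eqP; rewrite subr_eq0 => /eqP vE; apply: ij.
  move: E; rewrite -vE => /(mulfI (lt0r_neq0 (v_gt0 i0))) /addrI /oppr_inj.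
  by move/eqP; rewrite eqr_nat => /eqP.
by apply: (mulIf vij); rewrite divfK //; lra.
Qed.

Let before_wf : well_founded before.
Proof.
move=> t0; pose N := (Num.truncn t0).+1.
have tN : t0 < N%:R by rewrite truncnS_gt.
pose L := [seq (v i * i%:R - v j * j%:R) / (v i - v j)
          | i <- iota 0 N, j <- iota 0 N].
suff H m t : t <= t0 -> (count (fun x => x < t)%R L <= m)%N -> Acc before t.
  exact: (H _ t0 (lexx _) (leqnn _)).
have count_lt u t1 : t1 <= t0 -> before u t1 ->
    (count (fun x => x < u)%R L < count (fun x => x < t1)%R L)%N.
  move=> t10 [ut [i [j mij]]].
  have uL : u \in L.
    have [_ _ iu ju _] := mij; rewrite (meet_time mij).
    by apply: (allpairs_f (fun i j : nat =>
      (v i * i%:R - v j * j%:R) / (v i - v j)));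
      rewrite mem_iota /= add0n -(ltr_nat R); lra.
  elim: L uL => //= x l IHl; rewrite inE => /predU1P[<-|/IHl lt_l].
    by rewrite ltxx ut add0n add1n ltnS; apply: sub_count => y /lt_trans; exact.
  by rewrite -addnS leq_add //; case: (ltP x u) => // /lt_trans ->.
elim: m t => [|m IH] t tt0 cm; constructor => u b.
  by have := leq_trans (count_lt _ _ tt0 b) cm.
apply: IH; first by rewrite (le_trans (ltW b.1)).
by rewrite -ltnS (leq_trans (count_lt _ _ tt0 b) cm).
Qed.

Lemma bullet_dynamics_exists : exists alive, bullet_dynamics v alive.
Proof.
pose F (t : R) (rec : forall u, before u t -> nat -> Prop) (i : nat) : Prop :=
  [/\ (0 < i)%N, i%:R <= t & forall u j (b : before u t),
    ~ [/\ i <> j, rec u b i, rec u b j & bullet_pos v i u = bullet_pos v j u]].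
pose A := Fix before_wf (fun=> nat -> Prop) F.
have AE t : A t = F t (fun u _ => A u).
  rewrite /A Fix_eq // => x f g fg; congr F.
  by apply: functional_extensionality_dep => y;
     apply: functional_extensionality_dep => b; exact: fg.
exists (fun i t => A t i) => i t; rewrite AE; split=> -[i0 it H]; split=> //.
- move=> u j ut [ij Ai Aj E]; apply: (H u j) => //; split=> //.
  move: (Ai) (Aj); rewrite /= !AE => -[? ? _] [? ? _].
  by exists i, j.
- by move=> u j [ut _] C; exact: H ut C.
Qed.

Lemma bullet_dynamics_unique (a a' : nat -> R -> Prop) :
  bullet_dynamics v a -> bullet_dynamics v a' ->
  forall i t, a i t <-> a' i t.
Proof.
move=> da da' i t; elim/(well_founded_ind before_wf): t i => t IH i.
have meetP b u j k : bullet_dynamics v b -> collide v b j k u -> meet j k u.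
  by move=> db [jk /db[? ? _] /db[? ? _] ?]; split.
split=> [/da|/da'] [i0 it H].
- apply/da'; split=> // u j ut C.
  have b : before u t by split=> //; exists i, j; exact: meetP C.
  by apply: (H u j ut); case: C => ij /(IH u b) ? /(IH u b) ? ?; split.
- apply/da; split=> // u j ut C.
  have b : before u t by split=> //; exists i, j; exact: meetP C.
  by apply: (H u j ut); case: C => ij /(IH u b) ? /(IH u b) ? ?; split.
Qed.

End dynamics_well_posed.

(* Main.v *)
(* Exchanging time and space turns the bullets into particles that start from
   the integers and whose velocities are the inverse speeds.  Let [a < b] be
   the two smallest of the [n] velocities, and let [M N] be the expected number
   of surviving [b] minus that of surviving [a] among [N] random particles.

   (i) Fire one more particle on the right.  Whatever an [a] gains or destroys
   is balanced by the survival of a [b] fired in its place, hence [M] is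
   nondecreasing; moreover [M] increases by at least [eps * r k] from [k + K] to
   [k + K + 1], where [r k] is the probability that a [b] fired after [k] random
   particles survives.  A particle separates its two sides, so that
   [M N <= n^-1 * \sum_(j < N) r j * p (N - 1 - j)], where [p m] is the
   probability that a [b] followed by [m] random particles survives.  If [p]
   tended to 0, these inequalities would bound [\sum_j r j], and then [M] would
   tend to 0, although it is eventually at least a positive constant.

   (ii) By reflection, the second largest velocity [y] survives the particles on
   its left with positive probability.  If the largest velocity [z] survived the
   particles on its right with positive probability, so would [y], and by
   approximate independence some [z] and some [y] far to its right would both
   survive with positive probability, whereas [z] overtakes [y]. *)

Require Import Defs.
From mathcomp Require Import all_boot all_order all_algebra.
From mathcomp Require Import finmap lra ring zify.
From mathcomp Require Import all_classical all_reals all_analysis.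
Set Implicit Arguments.
Unset Strict Implicit.
Unset Printing Implicit Defensive.
Import Order.TTheory GRing.Theory Num.Theory.
Local Open Scope classical_set_scope.
Local Open Scope ring_scope.

(** * Annihilating particles on the line *)

Section dynamics.
Variable R : realType.
Implicit Types (w : nat -> R) (W : nat -> Prop) (al : nat -> R -> Prop).

Definition pos w (k : nat) (t : R) : R := k%:R + w k * t.

Definition clash w al (i j : nat) (t : R) : Prop :=
  [/\ i <> j, al i t, al j t & pos w i t = pos w j t].

(** As in [bullet_dynamics], a particle destroyed at time [t] still counts as alive at [t]. The
    predicate [W] selects the particles present, so that finite words and infinite configurations
    share one definition. *)
Definition ballistic W w al : Prop :=
  forall k t, al k t <->
    [/\ W k, 0 <= t & forall u j, u < t -> ~ clash w al k j u].

Definition finite_velocities w : Prop := exists S : seq R, forall k, w k \in S.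

(** Only potential meeting times are related, computed from the velocities in [S] and not from the
    trajectories; two processes can thus be compared by a single induction. *)
Let before (S : seq R) (u t : R) : Prop :=
  0 <= u < t /\ exists i j p q,
    [/\ i <> j, p \in S, q \in S & i%:R + p * u = j%:R + q * u].

Lemma seq_spread (S : seq R) : exists M, forall p q, p \in S -> q \in S -> p - q <= M.
Proof.
exists (\sum_(p <- S) `|p| *+ 2) => p q pS qS.
have H x : x \in S -> `|x| <= \sum_(p <- S) `|p|.
  by move=> xS; rewrite (big_rem x) //= lerDl sumr_ge0.
rewrite sumrMnl mulr2n; have := H _ pS; have := H _ qS.
by have := ler_norm p; have := ler_norm (- q); rewrite normrN; lra.
Qed.

(** Particles that meet by time [t0] start at a bounded distance, so finitely many potential meeting
    times precede [t0]; the number of those below [t] decreases along [before]. *)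
Lemma before_wf (S : seq R) : well_founded (before S).
Proof.
move=> t0; have [M SM] := seq_spread S.
pose N := (Num.truncn (`|t0| * M)).+1.
have tN : `|t0| * M < N%:R by rewrite truncnS_gt.
pose L := [seq d%:R / (p.1 - p.2) | d <- iota 0 N, p <- [seq (x, y) | x <- S, y <- S]].
suff H m t : t <= t0 -> (count (fun x => x < t)%R L <= m)%N -> Acc (before S) t.
  exact: (H _ t0 (lexx _) (leqnn _)).
have count_lt u t1 : t1 <= t0 -> before S u t1 ->
    (count (fun x => x < u)%R L < count (fun x => x < t1)%R L)%N.
  move=> t10 [/andP[u0 ut] [i0 [j0 [p0 [q0 [ij0 p0S q0S E0]]]]]].
  have {i0 j0 p0 q0 ij0 p0S q0S E0} [i [j [p [q [ij pS qS E]]]]] :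
      exists i j p q, [/\ (i < j)%N, p \in S, q \in S & i%:R + p * u = j%:R + q * u].
    have [lt|lt|//] := ltngtP i0 j0; first by exists i0, j0, p0, q0.
    by exists j0, i0, q0, p0.
  have ijR : i%:R < j%:R :> R by rewrite ltr_nat.
  have wd : p - q != 0 by apply/eqP => e; move: E; rewrite (_ : p = q); lra.
  have uE : u = (j - i)%:R / (p - q).
    apply: (mulIf wd); rewrite divfK // natrB; last exact: ltnW.
    by lra.
  have uL : u \in L.
    rewrite uE; apply: (allpairs_f (fun (d : nat) (p : R * R) => d%:R / (p.1 - p.2))
      _ (y := (p, q))); last by apply/allpairsP; exists (p, q).
    rewrite mem_iota /= add0n -(ltr_nat R) natrB; last exact: ltnW.
    apply: le_lt_trans tN; have -> : j%:R - i%:R = u * (p - q) by lra.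
    have := SM _ _ pS qS; have ut0 : u <= `|t0|.
      by have := ler_norm t0; lra.
    have wp : 0 <= p - q.
      rewrite leNgt; apply/negP => neg.
      suff : u * (p - q) <= 0 by lra.
      by rewrite mulr_ge0_le0 // ltW.
    by move=> ?; apply: ler_pM.
  elim: L uL => //= x l IHl; rewrite inE => /predU1P[<-|/IHl lt_l].
    by rewrite ltxx ut add0n add1n ltnS; apply: sub_count => y /lt_trans; exact.
  by rewrite -addnS leq_add //; case: (ltP x u) => // /lt_trans ->.
elim: m t => [|m IH] t tt0 cm; constructor => u b.
  by have := leq_trans (count_lt _ _ tt0 b) cm.
apply: IH; first by rewrite (le_trans _ tt0) // ltW //; case: b => /andP[].
by rewrite -ltnS (leq_trans (count_lt _ _ tt0 b) cm).
Qed.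

Lemma ballistic_exists W w : finite_velocities w -> exists al, ballistic W w al.
Proof.
move=> [S wS].
pose F (t : R) (rec : forall u, before S u t -> nat -> Prop) (i : nat) : Prop :=
  [/\ W i, 0 <= t & forall u j (b : before S u t),
    ~ [/\ i <> j, rec u b i, rec u b j & pos w i u = pos w j u]].
pose A := Fix (before_wf S) (fun=> nat -> Prop) F.
have AE t : A t = F t (fun u _ => A u).
  rewrite /A Fix_eq // => x f g fg; congr F.
  by apply: functional_extensionality_dep => y;
     apply: functional_extensionality_dep => b; exact: fg.
exists (fun i t => A t i) => i t; rewrite AE; split=> -[Wi t0 H]; split=> //.
- move=> u j ut [ij Ai Aj E]; apply: (H u j) => //; split=> //.
    by move: (Ai); rewrite /= !AE ut => -[_ ->].
  by exists i, j, (w i), (w j); rewrite !wS.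
- by move=> u j [/andP[_ ut] _] C; exact: H ut C.
Qed.

Section basic.
Variables (W : nat -> Prop) (w : nat -> R) (al : nat -> R -> Prop).
Hypothesis dyn : ballistic W w al.

Lemma al_in k t : al k t -> W k.
Proof. by move=> /dyn[]. Qed.

Lemma al_ge0 k t : al k t -> 0 <= t.
Proof. by move=> /dyn[]. Qed.

Lemma al_le k t u : al k t -> 0 <= u -> u <= t -> al k u.
Proof.
move=> /dyn[Wk t0 H] u0 ut; apply/dyn; split=> // r j ru.
exact/H/(lt_le_trans ru).
Qed.

Lemma al_clash i j t u : al i t -> u < t -> clash w al i j u -> False.
Proof. by move=> /dyn[_ _ H] ut; exact: H. Qed.

Lemma clash_sym i j t : clash w al i j t -> clash w al j i t.
Proof. by move=> [ij ai aj e]; split=> // ji; exact/ij. Qed.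

Lemma al_die k t : W k -> 0 <= t -> ~ al k t ->
  exists u j, u < t /\ clash w al k j u.
Proof.
move=> Wk t0; apply: contra_notP => H; apply/dyn; split=> // u j ut C.
by apply: H; exists u, j.
Qed.

(** Otherwise the two trajectories would cross at some time [r <= u], and that crossing would
    destroy both particles before [t]. *)
Lemma al_ltpos i j t u : al i t -> al j t -> (i < j)%N -> 0 <= u -> u < t ->
  pos w i u < pos w j u.
Proof.
move=> ai aj ij u0 ut; rewrite ltNge; apply/negP => le.
have ijR : i%:R < j%:R :> R by rewrite ltr_nat.
have d0 : 0 < w i - w j.
  rewrite ltNge; apply/negP => neg.
  have : (w i - w j) * u <= 0 by rewrite mulr_le0_ge0.
  by move: le; rewrite /pos; lra.
pose r := (j%:R - i%:R) / (w i - w j).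
have rE : r * (w i - w j) = j%:R - i%:R by rewrite divfK // gt_eqF.
have r0 : 0 <= r by rewrite divr_ge0 // ltW // subr_gt0.
have ru : r <= u.
  by rewrite ler_pdivrMr //; move: le; rewrite /pos; lra.
have rt := le_lt_trans ru ut.
apply: (al_clash ai rt (j := j)); split.
- by move=> e; rewrite e ltnn in ij.
- exact: al_le ai r0 (ltW rt).
- exact: al_le aj r0 (ltW rt).
- by rewrite /pos; lra.
Qed.

Lemma al_lepos i j t : al i t -> al j t -> (i <= j)%N -> pos w i t <= pos w j t.
Proof.
move=> ai aj; rewrite leq_eqVlt => /predU1P[->//|ij].
rewrite leNgt; apply/negP => lt; have t0 := al_ge0 ai.
have ijR : i%:R < j%:R :> R by rewrite ltr_nat.
have tp : 0 < t.
  rewrite lt_neqAle t0 andbT; apply/eqP => e; move: lt.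
  by rewrite /pos -e !mulr0; lra.
have d0 : 0 < w i - w j.
  rewrite ltNge; apply/negP => neg.
  have : (w i - w j) * t <= 0 by rewrite mulr_le0_ge0.
  by move: lt; rewrite /pos; lra.
pose r := (j%:R - i%:R) / (w i - w j).
have rE : r * (w i - w j) = j%:R - i%:R by rewrite divfK // gt_eqF.
have r0 : 0 <= r by rewrite divr_ge0 // ltW // subr_gt0.
have rt : r < t.
  by rewrite ltr_pdivrMr //; move: lt; rewrite /pos; lra.
have := al_ltpos ai aj ij r0 rt.
by rewrite /pos; lra.
Qed.

Lemma clash_gt0 i j t : clash w al i j t -> 0 < t.
Proof.
move=> [ij ai aj E]; rewrite lt_neqAle (al_ge0 ai) andbT.
apply/eqP => e; move: E; rewrite /pos -e !mulr0 !addr0 => /eqP.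
by rewrite eqr_nat => /eqP.
Qed.

Lemma clash_vel i j t : clash w al i j t -> (i < j)%N -> w j < w i.
Proof.
move=> C ij; have t0 := clash_gt0 C; case: C => _ _ _ E.
have ijR : i%:R < j%:R :> R by rewrite ltr_nat.
rewrite ltNge; apply/negP => neg.
have : 0 <= (w j - w i) * t by rewrite mulr_ge0 // ?subr_ge0 // ltW.
by move: E; rewrite /pos; lra.
Qed.

Lemma clash_between i k j t : clash w al i j t -> al k t -> (i <= k <= j)%N ->
  pos w k t = pos w i t.
Proof.
move=> [ij ai aj E] ak /andP[ik kj].
by apply/le_anti; rewrite (al_lepos ai ak ik) E (al_lepos ak aj kj).
Qed.

End basic.

(* [Z] is a backward-closed region of particles and times that no collision
   of either process can leave, so that both processes coincide on it. *)
Lemma ballistic_compare W1 w1 al1 W2 w2 al2 (Z : nat -> R -> Prop) :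
  finite_velocities w1 -> finite_velocities w2 ->
  ballistic W1 w1 al1 -> ballistic W2 w2 al2 ->
  (forall k t, Z k t -> w1 k = w2 k /\ (W1 k <-> W2 k)) ->
  (forall k t u, Z k t -> 0 <= u -> u < t -> Z k u) ->
  (forall k j t u, Z k t -> 0 <= u -> u < t -> (al1 k u <-> al2 k u) ->
     clash w1 al1 k j u \/ clash w2 al2 k j u -> Z j u) ->
  forall k t, Z k t -> (al1 k t <-> al2 k t).
Proof.
move=> [S1 wS1] [S2 wS2] d1 d2 ZW Zle Zcl k t.
elim/(well_founded_ind (before_wf (S1 ++ S2))): t k => t IH k Zk.
(* A collision before [t] in either process happens at a potential meeting time, so the induction
   hypothesis applies to both participants and the collision occurs in the other process too. *)
have key u j : 0 <= u -> u < t ->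
    clash w1 al1 k j u \/ clash w2 al2 k j u ->
    clash w1 al1 k j u /\ clash w2 al2 k j u.
  move=> u0 ut C; have Zku := Zle _ _ _ Zk u0 ut.
  have b : before (S1 ++ S2) u t.
    split; first by rewrite u0.
    by case: C => -[kj _ _ E]; [exists k, j, (w1 k), (w1 j)|exists k, j, (w2 k), (w2 j)];
      split=> //; rewrite mem_cat ?wS1 ?wS2 ?orbT.
  have ek := IH u b k Zku.
  have Zj := Zcl _ _ _ _ Zk u0 ut ek C.
  have ej := IH u b j Zj.
  have [wk _] := ZW _ _ Zku; have [wj _] := ZW _ _ Zj.
  have e i r : w1 i = w2 i -> pos w1 i r = pos w2 i r by rewrite /pos => ->.
  have ep := e _ u wk; have eq := e _ u wj.
  by case: C => -[kj ak aj E]; split; split=> //; try tauto; congruence.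
have [_ WE] := ZW _ _ Zk.
split=> [/d1|/d2] [Wk t0 H]; [apply/d2|apply/d1]; split=> //; try tauto.
- move=> u j ut C; apply: (H u j ut).
  by apply: (key u j _ ut _).1; [case: C => _ /d2[]|right].
- move=> u j ut C; apply: (H u j ut).
  by apply: (key u j _ ut _).2; [case: C => _ /d1[]|left].
Qed.

End dynamics.

(** * Finite words of velocities *)

Section words.
Variable R : realType.
Implicit Types (u v x : seq R) (a b c m t : R) (j k : nat).

Definition vel v k : R := @nth R 0 v k.

Lemma vel_finite v : finite_velocities (vel v).
Proof.
exists (0 :: v) => k; rewrite inE.
have [/(mem_nth (0 : R)) kv|/(nth_default (0 : R)) E] := ltnP k (size v).
  by rewrite [_ \in v]kv orbT.
by rewrite /vel E eqxx.
Qed.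

Definition alive v : nat -> R -> Prop :=
  sval (cid (ballistic_exists (fun k => (k < size v)%N) (vel_finite v))).

Lemma aliveP v : ballistic (fun k => (k < size v)%N) (vel v) (alive v).
Proof. exact: svalP (cid _). Qed.

Lemma alive_unique v al :
  ballistic (fun k => (k < size v)%N) (vel v) al -> forall k t, alive v k t <-> al k t.
Proof.
move=> d k t; have fv := vel_finite v.
exact: (ballistic_compare (Z := fun _ _ => True) fv fv (aliveP v) d).
Qed.

Notation ps v := (pos (vel v)).

Definition mirror v : seq R := [seq (- c : R) | c : R <- rev v].

Lemma size_mirror v : size (mirror v) = size v.
Proof. by rewrite size_map size_rev. Qed.

Lemma mirrorK : involutive mirror.
Proof.
move=> v; rewrite /mirror -map_rev revK -map_comp -[RHS]map_id.
by apply: eq_map => c /=; rewrite opprK.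
Qed.

Lemma mirror_cat u v : mirror (u ++ v) = mirror v ++ mirror u.
Proof. by rewrite /mirror rev_cat map_cat. Qed.

Lemma mirror_cons c v : mirror (c :: v) = rcons (mirror v) (- c).
Proof. by rewrite /mirror rev_cons map_rcons. Qed.

Lemma pos_mirror v k t : (k < size v)%N ->
  ps (mirror v) k t = (size v)%:R - 1 - ps v (size v - k.+1) t.
Proof.
move=> kv; rewrite /pos /vel (nth_map (0 : R)); last by rewrite size_rev.
by rewrite nth_rev // natrB // -(@natr1 R k) mulNr; lra.
Qed.

Lemma alive_mirror v k t : (k < size v)%N ->
  alive (mirror v) (size v - k.+1) t <-> alive v k t.
Proof.
move=> kv; rewrite (alive_unique (al := fun k t => (k < size v)%N /\ alive v (size v - k.+1) t)).
  rewrite (_ : (size v - (size v - k.+1).+1)%N = k); last by lia.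
  by split=> [[]//|?]; split=> //; lia.
clear k t kv => k t; rewrite size_mirror; split.
- move=> [{}kv ak]; split=> //; first exact: al_ge0 (aliveP v) _ _ ak.
  move=> u j ut [kj [_ a1] [jv a2] E].
  apply: (al_clash (aliveP v) ak ut (j := (size v - j.+1)%N)); split=> //; first by lia.
  by move: E; rewrite !pos_mirror //; lra.
- move=> [{}kv t0 H]; split=> //; apply/(aliveP v); split=> //; first by lia.
  move=> u j ut [kj a1 a2 E]; have jv := al_in (aliveP v) a2.
  apply: (H u (size v - j.+1)%N ut); split=> //.
  + by lia.
  + by split; [lia|rewrite (_ : (size v - _.+1)%N = j) //; lia].
  + rewrite !pos_mirror ?E //; last by lia.
    by rewrite (_ : (size v - (size v - j.+1).+1)%N = j) //; lia.
Qed.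

(** A particle that lives until [t] acts as a wall: a collision across it would take place at its
    own position and destroy it. *)
Lemma alive_left u c x k t : alive (u ++ c :: x) (size u) t -> (k <= size u)%N ->
  alive (u ++ c :: x) k t <-> alive (rcons u c) k t.
Proof.
move=> am km; set v := u ++ c :: x in am *; have dv := aliveP v.
pose Z k t := (k <= size u)%N /\ alive v (size u) t.
apply: (ballistic_compare (Z := Z) (vel_finite v) (vel_finite (rcons u c)) dv
  (aliveP _)) => //.
- clear k t am km => k t [km am]; rewrite /v /vel -cat_rcons size_cat size_rcons nth_cat size_rcons ltnS km.
  by split=> //; split=> // _; lia.
- clear k t am km => k t r [km am] r0 rt; split=> //; apply: al_le dv _ _ _ am r0 (ltW rt).
- clear k t am km => k j t r [km am] r0 rt _ C; split; last exact: al_le dv _ _ _ am r0 (ltW rt).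
  case: C => [C|[_ _ /(al_in (aliveP _))]]; last by rewrite size_rcons.
  rewrite leqNgt; apply/negP => jm.
  have amr := al_le dv am r0 (ltW rt).
  have [E|kne] := eqVneq k (size u); first by rewrite E in C; exact: al_clash dv _ _ _ _ am rt C.
  apply: (al_clash dv am rt (j := k)); split=> //; first by move=> e; rewrite e eqxx in kne.
    by case: C.
  by apply: (clash_between dv C amr); rewrite km ltnW.
Qed.

Lemma mirror_split u c x : mirror (u ++ c :: x) = mirror x ++ - c :: mirror u.
Proof. by rewrite mirror_cat mirror_cons cat_rcons. Qed.

Lemma alive_right u c x k t : alive (u ++ c :: x) (size u) t ->
  alive (u ++ c :: x) (size u + k) t <-> alive (c :: x) k t.
Proof.
move=> am; have [kx|kx] := leqP k (size x); last first.
  by split=> /(al_in (aliveP _)); rewrite ?size_cat /=; lia.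
have szE : size (u ++ c :: x) = (size u + (size x).+1)%N by rewrite size_cat.
have lt1 : (size u < size (u ++ c :: x))%N by lia.
have lt2 : (size u + k < size (u ++ c :: x))%N by lia.
have lt3 : (k < size (c :: x))%N by rewrite /=; lia.
move: am; rewrite -(alive_mirror t lt1) -(alive_mirror t lt2) -(alive_mirror t lt3).
rewrite mirror_split mirror_cons szE /= => am.
have e1 : (size u + (size x).+1 - (size u).+1 = size (mirror x))%N by rewrite size_mirror; lia.
rewrite e1 in am.
rewrite (alive_left am); last by rewrite size_mirror; lia.
by rewrite (_ : (size u + (size x).+1 - (size u + k).+1 = (size x).+1 - k.+1)%N) //; lia.
Qed.

(** If the middle particle is hit in the whole word, its partner lies on one side, and this side
    alone already produces the collision. *)
Lemma alive_mid u c x t : alive (u ++ c :: x) (size u) t <->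
  alive (rcons u c) (size u) t /\ alive (c :: x) 0 t.
Proof.
split=> [am|[al ar]].
  by split; [apply/(alive_left am)|apply/(alive_right 0 am); rewrite addn0].
have [//|nam] := pselect (alive (u ++ c :: x) (size u) t); exfalso.
have [r [j [rt C]]] := al_die (aliveP (u ++ c :: x)) (k := size u) (t := t)
  ltac:(by rewrite size_cat /=; lia) (al_ge0 (aliveP _) al) nam.
have [mj am aj E] := C; have r0 := al_ge0 (aliveP _) am.
have [jm|mjlt] := leqP j (size u).
  apply: (al_clash (aliveP _) al rt (j := j)); split=> //.
  - by apply/(alive_left am).
  - by apply/(alive_left am jm).
  - by move: E; rewrite /pos /vel -cat_rcons !nth_cat size_rcons !ltnS leqnn jm.
have jE : j = (size u + (j - size u))%N by lia.
apply: (al_clash (aliveP _) ar rt (j := (j - size u)%N)); split=> //.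
- by lia.
- by apply/(alive_right 0 am); rewrite addn0.
- by apply/(alive_right _ am); rewrite -jE.
- move: E; rewrite /pos /vel !nth_cat ltnn subnn (ltnNge j) (ltnW mjlt) /= natrB; last exact: ltnW.
  by lra.
Qed.

Lemma alive_rcons v c k t : alive (rcons v c) (size v) t -> (k < size v)%N ->
  alive (rcons v c) k t <-> alive v k t.
Proof.
move=> aN kv; set v' := rcons v c in aN *; have dv := aliveP v'.
pose Z k t := (k < size v)%N /\ alive v' (size v) t.
apply: (ballistic_compare (Z := Z) (vel_finite v') (vel_finite v) dv (aliveP _)) => //.
- clear k t aN kv => k t [km am]; rewrite /v' /vel size_rcons nth_rcons km.
  by split=> //; split=> // _; lia.
- clear k t aN kv => k t r [kv aN] r0 rt; split=> //; apply: al_le dv _ _ _ aN r0 (ltW rt).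
- clear k t aN kv => k j t r [kv aN] r0 rt _ C; split; last exact: al_le dv _ _ _ aN r0 (ltW rt).
  case: C => [C|[_ _ /(al_in (aliveP _))]] //.
  have [_ _ /(al_in dv)] := C; rewrite size_rcons ltnS leq_eqVlt => /predU1P[e|//] _.
  by exfalso; rewrite e in C; apply: (al_clash dv aN rt (clash_sym C)).
Qed.

(** Until its own collision the last particle has no influence, so its survival is read off the
    trajectories of [v] alone. This makes the dependence on [c] monotone. *)
Lemma alive_last v c t : alive (rcons v c) (size v) t <->
  0 <= t /\ forall k r, r < t -> alive v k r -> ps v k r < (size v)%:R + c * r.
Proof.
have dv := aliveP (rcons v c).
have pE k r : (k < size v)%N -> ps (rcons v c) k r = ps v k r by move=> kv; rewrite /pos /vel nth_rcons kv.
have pN r : ps (rcons v c) (size v) r = (size v)%:R + c * r by rewrite /pos /vel nth_rcons ltnn eqxx.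
split=> [aN|[t0 H]].
  split=> [|k r rt ak]; first exact: al_ge0 dv _ _ aN.
  have r0 := al_ge0 (aliveP _) ak; have kv := al_in (aliveP _) ak.
  have aNr := al_le dv aN r0 (ltW rt); have akr : alive (rcons v c) k r by apply/(alive_rcons aNr kv).
  have := al_lepos dv akr aNr (ltnW kv); rewrite pE // pN le_eqVlt => /predU1P[E|//]; exfalso.
  apply: (al_clash dv aN rt (j := k)); split=> //; last by rewrite pN pE.
  by move=> e; rewrite e ltnn in kv.
have [//|naN] := pselect (alive (rcons v c) (size v) t); exfalso.
have [r [j [rt [Nj aN aj]]]] := al_die dv (k := size v) ltac:(by rewrite size_rcons) t0 naN.
have jv : (j < size v)%N.
  by have := al_in dv aj; rewrite size_rcons ltnS leq_eqVlt => /predU1P[/esym|].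
rewrite pN pE // => E.
by have := H j r rt ((alive_rcons aN jv).1 aj); rewrite E ltxx.
Qed.

(** Finite speed of propagation: no velocity is below [m], so particles starting beyond [v] never
    get below the line [size v + m * t], and a trajectory below this line at time [t] was below it
    before. *)
Lemma alive_cone (W : nat -> Prop) w al v m k t : finite_velocities w -> ballistic W w al ->
  (forall k, (k < size v)%N -> W k /\ w k = vel v k) -> (forall k, W k -> m <= w k) ->
  (k < size v)%N -> pos w k t < (size v)%:R + m * t -> (al k t <-> alive v k t).
Proof.
move=> fw d Wv mw kv kt.
pose Z k t := (k < size v)%N /\ pos w k t < (size v)%:R + m * t.
apply: (ballistic_compare (Z := Z) fw (vel_finite v) d (aliveP _)) => //.
- clear k t kv kt => k t [kv _]; have [Wk wk] := Wv k kv.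
  by split=> //; split.
- clear k t kv kt => k t r [kv kt] r0 rt; split=> //; have [Wk _] := Wv _ kv.
  have : 0 <= (w k - m) * (t - r) by rewrite mulr_ge0 // subr_ge0 ?mw // ltW.
  by move: kt; rewrite /pos; lra.
- clear k t kv kt => k j t r [kv kt] r0 rt _ C; have [Wk _] := Wv _ kv.
  have kr : pos w k r < (size v)%:R + m * r.
    have : 0 <= (w k - m) * (t - r) by rewrite mulr_ge0 // subr_ge0 ?mw // ltW.
    by move: kt; rewrite /pos; lra.
  have [jv|jv] := ltnP j (size v).
    split=> //; suff -> : pos w j r = pos w k r by [].
    case: C => -[_ _ _] // E; rewrite /pos.
    by move: E; rewrite /pos -(Wv k kv).2 -(Wv j jv).2.
  case: C => [[_ _ aj E]|[_ _ /(al_in (aliveP _))]]; last by rewrite ltnNge jv.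
  exfalso; move: kr; rewrite E /pos; have := mw _ (al_in d aj).
  have : (size v)%:R <= j%:R :> R by rewrite ler_nat.
  move=> ? ?; have : 0 <= (w j - m) * r by rewrite mulr_ge0 // subr_ge0.
  by lra.
Qed.

End words.

(** * Survival of the first and of the last particle *)

Section survival.
Variable R : realType.
Implicit Types (u v x y : seq R) (c t : R) (j k : nat).

Notation ps v := (pos (vel v)).
Notation clashes v := (clash (vel v) (alive v)).

Definition first_survives c v : Prop := forall t, 0 <= t -> alive (c :: v) 0 t.
Definition last_survives v c : Prop := forall t, 0 <= t -> alive (rcons v c) (size v) t.

Lemma last_survivesP v c : last_survives v c <->
  forall k t, alive v k t -> ps v k t < (size v)%:R + c * t.
Proof.
split=> [H k t ak|H t t0]; last by apply/alive_last; split=> // k r _; exact: H.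
have t0 := al_ge0 (aliveP _) ak.
have /alive_last[_ H'] := H (t + 1) ltac:(lra).
by apply: H' => //; lra.
Qed.

Lemma last_survives_le v c c' : c <= c' -> last_survives v c -> last_survives v c'.
Proof.
move=> cc' /last_survivesP H; apply/last_survivesP => k t ak.
apply: (lt_le_trans (H k t ak)); rewrite lerD2l ler_wpM2r //.
exact: al_ge0 (aliveP _) _ _ ak.
Qed.

Lemma first_survives_mirror c v : first_survives c v <-> last_survives (mirror v) (- c).
Proof.
rewrite /first_survives /last_survives -mirror_cons size_mirror.
have h t := @alive_mirror R (c :: v) 0 t isT.
rewrite /= subSS subn0 in h.
by split=> H t t0; [apply/h|apply/h]; exact: H.
Qed.

Lemma alive_first_le c c' v t : c' <= c -> alive (c :: v) 0 t -> alive (c' :: v) 0 t.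
Proof.
move=> cc'; have h e := @alive_mirror R (e :: v) 0 t isT.
rewrite -!h /= subSS subn0 !mirror_cons -(size_mirror v) !alive_last => -[t0 H].
split=> // k r rt ak; apply: (lt_le_trans (H k r rt ak)).
by rewrite lerD2l ler_wpM2r ?lerN2 // (al_ge0 (aliveP _) ak).
Qed.

Lemma first_dies c v : ~ first_survives c v -> exists j t, clashes (c :: v) 0 j t.
Proof.
move=> /existsNP[t /not_implyP[t0 nal]].
by have [r [j [_ C]]] := al_die (aliveP (c :: v)) (k := 0) isT t0 nal; exists j, r.
Qed.

Lemma clash_first_dies c v j t : clashes (c :: v) 0 j t -> ~ first_survives c v.
Proof.
move=> C H; have [_ a0 _ _] := C; have t0 := al_ge0 (aliveP _) a0.
apply: (al_clash (aliveP _) (H (t + 1) ltac:(lra)) _ C); lra.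
Qed.

Lemma split_nth v j : (j < size v)%N ->
  v = take j v ++ vel v j :: drop j.+1 v.
Proof. by move=> jv; rewrite -drop_nth // cat_take_drop. Qed.

Lemma vel_cat_mid u c x : vel (u ++ c :: x) (size u) = c.
Proof. by rewrite /vel nth_cat ltnn subnn. Qed.

Lemma pos_cat_mid u c x t : ps (u ++ c :: x) (size u) t = (size u)%:R + c * t.
Proof. by rewrite /pos vel_cat_mid. Qed.

Lemma pos_catl u x k t : (k < size u)%N -> ps (u ++ x) k t = ps u k t.
Proof. by move=> ku; rewrite /pos /vel nth_cat ku. Qed.

Lemma pos_catr u x k t : ps (u ++ x) (size u + k) t = (size u)%:R + ps x k t.
Proof.
by rewrite /pos /vel nth_cat ltnNge leq_addr /= addKn natrD addrA.
Qed.

Lemma survives_mid u c x t : last_survives u c -> first_survives c x -> 0 <= t ->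
  alive (u ++ c :: x) (size u) t.
Proof. by move=> L H t0; apply/alive_mid; split; [exact: L|exact: H]. Qed.

Lemma vel_in (S : seq R) v j : {subset v <= S} -> (j < size v)%N -> vel v j \in S.
Proof. by move=> vS jv; apply: vS; rewrite mem_nth. Qed.

Lemma sub_cons (S : seq R) c v : {subset c :: v <= S} <-> c \in S /\ {subset v <= S}.
Proof.
split=> [H|[cS vS] e]; last by rewrite inE => /predU1P[->//|/vS].
by split=> [|e ev]; apply: H; rewrite inE ?eqxx ?ev ?orbT.
Qed.

Lemma sub_cat (S : seq R) u v : {subset u ++ v <= S} <-> {subset u <= S} /\ {subset v <= S}.
Proof.
split=> [H|[uS vS] e]; last by rewrite mem_cat => /orP[/uS|/vS].
by split=> e eu; apply: H; rewrite mem_cat eu ?orbT.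
Qed.

Lemma sub_rcons (S : seq R) c v : {subset rcons v c <= S} <-> c \in S /\ {subset v <= S}.
Proof. by rewrite -cats1 sub_cat sub_cons; split=> [[? []]|[? ?]]. Qed.

Variables (S : seq R) (a b : R).
Hypotheses (a_min : {in S, forall c, a <= c}) (b_snd : {in S, forall c, c < b -> c = a}).
Hypotheses (aS : a \in S) (bS : b \in S) (ab : a < b).

Lemma alive_first_min x t : {subset x <= S} -> 0 <= t -> alive (a :: x) 0 t.
Proof.
move=> xS t0; have [//|nal] := pselect (alive (a :: x) 0 t); exfalso.
have [r [j [_ C]]] := al_die (aliveP (a :: x)) (k := 0) isT t0 nal.
have [ne0 _ aj _] := C.
have jx := al_in (aliveP _) aj.
have vS : vel (a :: x) j \in S by apply: vel_in jx; exact/sub_cons.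
have := clash_vel (aliveP _) C; rewrite lt0n; case: j ne0 {aj C} vS {jx} => // j _ vS /(_ isT).
by have := a_min vS; rewrite /vel /=; lra.
Qed.

(* The velocity [a] is minimal, so nothing coming from the right can destroy
   the particle [a] before the collision. *)
Lemma clash_transfer u x y t : {subset x <= S} -> {subset y <= S} ->
  clashes (u ++ a :: x) 0 (size u) t -> clashes (u ++ a :: y) 0 (size u) t.
Proof.
move=> xS yS [ne0 a0 au E]; have t0 := al_ge0 (aliveP _) a0.
have /alive_mid[al _] := au.
have au' : alive (u ++ a :: y) (size u) t.
  by apply/alive_mid; split=> //; exact: alive_first_min.
split=> //; first by apply/(alive_left au' (leq0n _)); exact/(alive_left au (leq0n _)).
move: E; rewrite !pos_cat_mid => <-.
by rewrite -!cat_rcons !pos_catl // size_rcons.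
Qed.

Lemma first_b_dies_by v j t : {subset v <= S} -> clashes (b :: v) 0 j t ->
  (0 < j)%N /\ vel (b :: v) j = a.
Proof.
move=> vS C; have [ne0 _ aj _] := C; have jv := al_in (aliveP _) aj.
have j0 : (0 < j)%N by case: j ne0 {aj C jv}.
split=> //; have := clash_vel (aliveP _) C j0.
have : vel (b :: v) j \in S by apply: vel_in jv; exact/sub_cons.
exact: b_snd.
Qed.

(** Only an [a] can hit the leading [b], and by [clash_transfer] the letters after that [a] do not
    affect the collision. *)
Lemma first_b_dies_transfer v x y j t : {subset v <= S} -> {subset x <= S} -> {subset y <= S} ->
  clashes (b :: v ++ x) 0 j t -> (j <= size v)%N -> clashes (b :: v ++ y) 0 j t.
Proof.
move=> vS xS yS C jv.
have [j0 ja] := first_b_dies_by ((sub_cat _ _ _).2 (conj vS xS)) C.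
have jv' : (j < size (b :: v))%N by [].
have E : b :: v = take j (b :: v) ++ a :: drop j.+1 (b :: v).
  rewrite -[a]ja -cat_cons [vel _ j](_ : _ = vel (b :: v) j); first exact: split_nth.
  by rewrite /vel nth_cat jv'.
move: C; rewrite -!cat_cons E -!catA !cat_cons.
have sj : size (take j (b :: v)) = j by rewrite size_takel // ltnW.
have dS : {subset drop j.+1 (b :: v) <= S}.
  by move=> e /mem_drop; apply: ((sub_cons _ _ _).2 (conj bS vS)).
set u := take j _ in sj *; rewrite -sj; by apply: clash_transfer; apply/sub_cat; rewrite sj.
Qed.

Lemma first_b_rcons v c : {subset v <= S} -> c \in S ->
  first_survives b (rcons v c) -> first_survives b v.
Proof.
move=> vS cS H; have [//|/first_dies[j [t C]]] := pselect (first_survives b v); exfalso.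
have [_ _ /(al_in (aliveP _)) jv _] := C.
rewrite -[v]cats0 in C; have nS : {subset [::] <= S} by [].
have cS' : {subset [:: c] <= S} by move=> e; rewrite inE => /eqP->.
have /clash_first_dies := first_b_dies_transfer vS nS cS' C jv.
by rewrite cats1.
Qed.

Lemma first_b_rcons_dies v c : {subset v <= S} -> c \in S ->
  first_survives b v -> ~ first_survives b (rcons v c) ->
  c = a /\ exists t, clashes (b :: rcons v c) 0 (size v).+1 t.
Proof.
move=> vS cS H /first_dies[j [t C]].
have [_ _ /(al_in (aliveP _)) jv _] := C.
have cS' : {subset [:: c] <= S} by move=> e; rewrite inE => /eqP->.
have vcS : {subset rcons v c <= S} by exact/sub_rcons.
move: jv; rewrite /= size_rcons !ltnS leq_eqVlt => /predU1P[E|jv].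
  have [_] := first_b_dies_by vcS C.
  rewrite E /vel /= nth_rcons ltnn eqxx => ca; split=> //.
  by exists t; rewrite -E.
exfalso; move: C; rewrite -cats1 => C.
have nS : {subset [::] <= S} by [].
have := first_b_dies_transfer vS cS' nS C jv.
by rewrite cats0 => /clash_first_dies.
Qed.

Lemma first_b_rcons_neq v c : {subset v <= S} -> c \in S -> c != a ->
  first_survives b (rcons v c) <-> first_survives b v.
Proof.
move=> vS cS /eqP ca; split; first exact: first_b_rcons.
by move=> H; have [//|/(first_b_rcons_dies vS cS H)[]] := pselect (first_survives b (rcons v c)).
Qed.

(* The particle [b] fired after [u] survives in the word [u ++ b :: x], but an
   additional particle [a] fired after this word hits it. *)
Definition hit_by_next u x : Prop :=
  [/\ last_survives u b, first_survives b x & ~ first_survives b (rcons x a)].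

(** * A surviving [b] that the next [a] destroys *)

Section hit.
Variables u x : seq R.
Hypotheses (xS : {subset x <= S}) (hit : hit_by_next u x).
Let v := u ++ b :: x.

Lemma hit_clash : exists t, clashes (rcons v a) (size u) (size v) t.
Proof.
have [Lu Hx nHx] := hit.
have [_ [t C]] := first_b_rcons_dies xS aS Hx nHx; exists t.
have [_ a0 al E] := C; have t0 := al_ge0 (aliveP _) a0.
have vE : rcons v a = u ++ b :: rcons x a by rewrite /v rcons_cat.
have svE : size v = (size u + (size x).+1)%N by rewrite /v size_cat.
have au : alive (u ++ b :: rcons x a) (size u) t by apply/alive_mid; split=> //; exact: Lu.
rewrite vE svE; split=> //; first by lia.
- exact/(alive_right _ au).
- by rewrite pos_cat_mid pos_catr -E /pos mulr0n add0r.
Qed.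

Lemma hit_not_last_survives : ~ last_survives v a.
Proof.
have [t C] := hit_clash => L; have [_ _ aN _] := C; have t0 := al_ge0 (aliveP _) aN.
apply: (al_clash (aliveP _) (L (t + 1) ltac:(lra)) _ (clash_sym C)); lra.
Qed.

Lemma hit_survives t : 0 <= t -> alive v (size u) t.
Proof. by have [Lu Hx _] := hit; exact: survives_mid. Qed.

(** What starts to the left of the surviving [b] stays behind it, hence behind the new [b], which is
    parallel to it. What starts to its right is behind the additional [a], hence behind the new [b],
    until the collision of [hit_clash]; if still alive then, it would be squeezed between the two
    and hit the surviving [b]. *)
Lemma hit_last_survives : last_survives v b.
Proof.
apply/last_survivesP => k t ak; have t0 := al_ge0 (aliveP _) ak.
have kv := al_in (aliveP _) ak; have au := hit_survives t0.
have uv : (size u < size v)%N by rewrite /v size_cat /=; lia.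
have uvR : (size u)%:R < (size v)%:R :> R by rewrite ltr_nat.
have [ku|uk] := leqP k (size u).
  apply: (le_lt_trans (al_lepos (aliveP _) ak au ku)).
  by rewrite /v pos_cat_mid ltrD2r.
have [r C] := hit_clash; have [_ auN aN E] := C; have r0 := al_ge0 (aliveP _) aN.
have pN : ps (rcons v a) (size v) r = (size v)%:R + a * r.
  by rewrite /pos /vel nth_rcons ltnn eqxx.
have pE j s : (j < size v)%N -> ps (rcons v a) j s = ps v j s.
  by move=> jv; rewrite -cats1 pos_catl.
have [tr|rt] := leP t r.
  have aNt := al_le (aliveP _) aN t0 tr.
  have := al_lepos (aliveP _) ((alive_rcons aNt kv).2 ak) aNt (ltnW kv).
  have kvR : k%:R < (size v)%:R :> R by rewrite ltr_nat.
  rewrite pE // {2}/pos {2}/vel nth_rcons ltnn eqxx.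
  have [->|tn0] := eqVneq t 0; first by rewrite /pos !mulr0; lra.
  have : a * t < b * t by rewrite ltr_pM2r // lt_neqAle eq_sym tn0.
  by lra.
exfalso; have akr := al_le (aliveP _) ak r0 (ltW rt).
have akr' := (alive_rcons aN kv).2 akr.
have := clash_between (aliveP _) C akr' ltac:(lia).
rewrite !pE // => E'.
apply: (al_clash (aliveP _) au rt (j := k)); split=> //; first by lia.
exact: hit_survives.
Qed.

End hit.

(** The additional [a] dies only once, so both collisions are one event; two particles [b] at one
    place at the same time have the same starting point. *)
Lemma hit_unique u x u' x' : {subset x <= S} -> {subset x' <= S} ->
  u ++ b :: x = u' ++ b :: x' ->
  hit_by_next u x -> hit_by_next u' x' -> size u = size u'.
Proof.
move=> xS x'S E h h'.
have [t C] := hit_clash xS h; have [t' C'] := hit_clash x'S h'.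
move: C C'; rewrite -E; set v := u ++ b :: x => C C'.
have [_ au aN pE] := C; have [_ au' aN' pE'] := C'.
have tt : t = t'.
  have [lt|lt|//] := ltgtP t t'; exfalso.
    exact: al_clash (aliveP _) _ _ _ _ aN' lt (clash_sym C).
  exact: al_clash (aliveP _) _ _ _ _ aN lt (clash_sym C').
subst t'; move: pE; rewrite -pE'.
have uv : (size u < size v)%N by rewrite /v size_cat /=; lia.
have u'v : (size u' < size v)%N by rewrite /v E size_cat /=; lia.
rewrite -cats1 !(@pos_catl v [:: a]) // {1}/v pos_cat_mid /v E pos_cat_mid => /addIr /eqP.
by rewrite eqr_nat => /eqP.
Qed.

End survival.

Ltac natlia := repeat match goal with
  | H : is_true (Order.le _ _) |- _ => clear H
  | H : is_true (Order.lt _ _) |- _ => clear H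
  | H : @eq (Real.sort _) _ _ |- _ => clear H
  end; lia.

(** * The trap, a suffix that separates the fates of [a] and [b] *)

Section trap.
Variable R : realType.
Implicit Types (u v x : seq R) (c t r : R) (i j k : nat).

Notation ps v := (pos (vel v)).
Notation clashes v := (clash (vel v) (alive v)).

Variables (S : seq R) (a b z : R).
Hypotheses (a_min : {in S, forall c, a <= c}) (b_snd : {in S, forall c, c < b -> c = a}).
Hypotheses (z_max : {in S, forall c, c <= z}).
Hypotheses (aS : a \in S) (bS : b \in S) (zS : z \in S) (ab : a < b) (bz : b < z).

(** [z] can only be hit from its right and [a] only from its left, so each of the two shields the
    other until they meet. *)
Lemma adjacent_clash v j : {subset v <= S} -> (j.+1 < size v)%N ->
  vel v j = z -> vel v j.+1 = a -> clashes v j j.+1 (z - a)^-1.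
Proof.
move=> vS jv vj vj1; have dv := aliveP v.
have [ltab ltbz] := (ab, bz).
have za : 0 < z - a by lra.
have tE : (z - a) * (z - a)^-1 = 1 by rewrite mulfV // gt_eqF.
have t0 : 0 <= (z - a)^-1 by rewrite invr_ge0 ltW.
have meet r : ps v j r = ps v j.+1 r -> r = (z - a)^-1.
  rewrite /pos vj vj1 -natr1 => E; apply: (mulfI (lt0r_neq0 za)); lra.
have velS i r k : clashes v k i r -> a <= vel v i <= z.
  by move=> [_ _ /(al_in dv) iv _]; rewrite a_min ?z_max ?vel_in.
have right i r : clashes v j i r -> (j < i)%N.
  move=> C; have [ji _ _ _] := C; have /andP[ai iz] := velS _ _ _ C.
  have [lt|//|E] := ltngtP i j; last by case: ji.
  by have := clash_vel dv (clash_sym C) lt; rewrite vj; lra.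
have left i r : clashes v j.+1 i r -> (i < j.+1)%N.
  move=> C; have [ji _ _ _] := C; have /andP[ai iz] := velS _ _ _ C.
  have [lt|//|E] := ltngtP j.+1 i; last by case: ji.
  by have := clash_vel dv C lt; rewrite vj1; lra.
have left_clash i r : alive v j r -> clashes v j.+1 i r -> r = (z - a)^-1.
  move=> ajr C; have := left _ _ C; rewrite ltnS leq_eqVlt => /predU1P[e|ij].
    by apply: meet; rewrite e in C; case: C => _ _ _ ->.
  have C' := clash_sym C; apply: meet.
  have E := clash_between dv C' ajr ltac:(natlia).
  by rewrite E; have [_ _ _] := C'.
have aj : alive v j (z - a)^-1.
  have [//|nal] := pselect (alive v j (z - a)^-1); exfalso.
  have [r [i [rt C]]] := al_die dv (ltnW jv) t0 nal.
  have [_ ajr air E] := C; have r0 := al_ge0 dv ajr; have ji := right _ _ C.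
  have [aj1|naj1] := pselect (alive v j.+1 r).
    by have := meet r (esym (clash_between dv C aj1 ltac:(natlia))); lra.
  have [r' [i' [r'r C']]] := al_die dv jv r0 naj1.
  have [_ aj1' _ _] := C'.
  by have := left_clash _ _ (al_le dv ajr (al_ge0 dv aj1') (ltW r'r)) C'; lra.
have aj1 : alive v j.+1 (z - a)^-1.
  have [//|nal] := pselect (alive v j.+1 (z - a)^-1); exfalso.
  have [r [i [rt C]]] := al_die dv jv t0 nal.
  have [_ aj1r _ _] := C.
  by have := left_clash _ _ (al_le dv aj (al_ge0 dv aj1r) (ltW rt)) C; lra.
by split=> //; rewrite /pos vj vj1 -natr1; lra.
Qed.

(* In the word [z (z a)^n b] the pairs [(z a)] disappear at once; a particle [a]
   fired next catches [b] before [b] meets the first [z], whereas a particle [b]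
   fired next meets nothing. *)
Definition trap n : seq R := mkseq (fun k => if k == n.*2.+1 then b
  else if (k == 0) || odd k then z else a) n.*2.+2.

Lemma size_trap n : size (trap n) = n.*2.+2.
Proof. exact: size_mkseq. Qed.

Lemma trap_sub n : {subset trap n <= S}.
Proof.
move=> c /(nthP (0 : R))[i]; rewrite size_trap => iv <-; rewrite nth_mkseq //.
by case: ifP => // _; case: ifP.
Qed.

Section after.
Variables (v w : seq R) (m n e : nat).
Hypotheses (wS : {subset w <= S}) (Lv : last_survives v b).
Hypothesis hn : z - b <= n.*2.+1%:R * (b - a).
Hypotheses (sv : size v = m) (sw : size w = e.+1) (eE : e = (m + n.*2.+1)%N).
Hypothesis wv : forall k, (k < m)%N -> vel w k = vel v k.
Hypothesis vel_w : forall k, (k < n.*2.+2)%N -> vel w (m + k) =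
  if k == n.*2.+1 then b else if (k == 0) || odd k then z else a.

Let dw := aliveP w.

Let vel_m : vel w m = z.
Proof. by rewrite -[m]addn0 vel_w. Qed.

Let vel_e : vel w e = b.
Proof. by rewrite eE vel_w // eqxx. Qed.

Let pos_m t : ps w m t = m%:R + z * t.
Proof. by rewrite /pos vel_m. Qed.

Let pos_e t : ps w e t = m%:R + n.*2.+1%:R + b * t.
Proof. by rewrite /pos vel_e eE natrD. Qed.

Let za : 0 < z - a. Proof. by have [ltab ltbz] := (ab, bz); lra. Qed.

(** The particle belongs to one of the pairs [(z a)], hence lives at most until [(z - a)^-1]; up to
    then it stays strictly between the first [z] and the final [b]. *)
Let inner k t : (m < k < e)%N -> alive w k t ->
  [/\ m%:R + z * t < ps w k t, ps w k t < ps w e t & (z - a) * t <= 1].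
Proof.
move=> /andP[mk ke] ak; have t0 := al_ge0 dw ak.
pose i := (k - m)%N; have kE : k = (m + i)%N by rewrite /i; natlia.
have i0 : (0 < i)%N by natlia.
have ie : (i < n.*2.+1)%N by natlia.
have iR : i%:R <= n.*2%:R :> R by rewrite ler_nat; natlia.
have nE : n.*2.+1%:R = n.*2%:R + 1 :> R by rewrite -natr1.
have bt : a * t <= b * t by rewrite ler_wpM2r // ltW.
have zt : b * t <= z * t by rewrite ler_wpM2r // ltW.
have lt1 j : clashes w j j.+1 (z - a)^-1 -> alive w j t \/ alive w j.+1 t -> (z - a) * t <= 1.
  move=> C; rewrite -ler_pdivlMl // mulr1 => alv; rewrite leNgt; apply/negP => lt.
  by case: alv => [al|al]; [exact: al_clash dw _ _ _ _ al lt C|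
    exact: al_clash dw _ _ _ _ al lt (clash_sym C)].
have ine : (i == n.*2.+1) = false by apply/negbTE; natlia.
have in0 : (i == 0) = false by apply/negbTE; natlia.
have vi : vel w (m + i) = if odd i then z else a.
  by rewrite vel_w ?ine ?in0 //; natlia.
rewrite pos_e /pos [in vel w k]kE [in k%:R]kE natrD vi.
have [oi|ei] /= := boolP (odd i).
  have i1e : (i.+1 < n.*2.+1)%N by have := odd_double n; natlia.
  have C : clashes w k k.+1 (z - a)^-1.
    apply: adjacent_clash => //; first by rewrite sw; natlia.
      by rewrite kE vi oi.
    rewrite kE -addnS vel_w; last by natlia.
    by rewrite /= oi ifF //; apply/negbTE; natlia.
  have h := lt1 _ C (or_introl ak).
  have i1R : i%:R + 1 <= n.*2%:R :> R by rewrite natr1 ler_nat; natlia.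
  have iR0 : 0 < i%:R :> R by rewrite ltr0n.
  by split=> //; lra.
have C : clashes w k.-1 k (z - a)^-1.
  have -> : k = k.-1.+1 by natlia.
  apply: adjacent_clash => //; first by rewrite sw; natlia.
    rewrite (_ : k.-1.+1.-1 = m + i.-1)%N; last by natlia.
    rewrite vel_w; last by natlia.
    rewrite ifF; last by apply/negbTE; natlia.
    by rewrite ifT //; apply/orP; right; natlia.
  rewrite (_ : k.-1.+1 = m + i)%N; last by natlia.
  by rewrite vi (negPf ei).
have h := lt1 k.-1; rewrite prednK in h; last by natlia.
have {}h := h C (or_intror ak).
have i1R : 1 < i%:R :> R by rewrite ltr1n; natlia.
by split=> //; lra.
Qed.

(** The time at which the first [z] and the final [b] of the trap meet. *)
Let t1 : R := n.*2.+1%:R / (z - b).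
Let t1E : (z - b) * t1 = n.*2.+1%:R.
Proof. by rewrite mulrC divfK // subr_eq0 gt_eqF. Qed.
Let t1_ge0 : 0 <= t1. Proof. by rewrite divr_ge0 // subr_ge0 ltW. Qed.

Let meet r : ps w m r = ps w e r -> r = t1.
Proof.
have zb : z - b != 0 by rewrite subr_eq0 gt_eqF.
by rewrite pos_m pos_e => E; apply: (mulfI zb); rewrite t1E; lra.
Qed.

Let le_e k t : alive w k t -> (k <= e)%N.
Proof. by move=> /(al_in dw); rewrite sw. Qed.

Let alive_m : alive w m t1.
Proof.
have [//|nal] := pselect (alive w m t1); exfalso.
have [r [i [rt C]]] := al_die dw (k := m) ltac:(rewrite sw; natlia) t1_ge0 nal.
have [mi _ ai E] := C; have ie := le_e ai.
have [im|mi'|im] := ltngtP i m; last by case: mi.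
  have := clash_vel dw (clash_sym C) im; rewrite vel_m.
  by have := z_max (vel_in wS (al_in dw ai)); lra.
move: ie; rewrite leq_eqVlt => /predU1P[ie|ie].
  by move: E; rewrite ie => /meet; lra.
by have [] := inner (k := i) ltac:(natlia) ai; rewrite -pos_m E; lra.
Qed.

Let alive_e : alive w e t1.
Proof.
have [//|nal] := pselect (alive w e t1); exfalso.
have [r [i [rt C]]] := al_die dw (k := e) ltac:(by rewrite sw) t1_ge0 nal.
have [ei ae ai E] := C; have ie := le_e ai; have r0 := al_ge0 dw ai.
have [im|mi] := leqP i m.
  have am := al_le dw alive_m r0 (ltW rt).
  have := clash_between dw (clash_sym C) am ltac:(natlia).
  by rewrite -E => /meet; lra.
by have [] := inner (k := i) ltac:(natlia) ai; rewrite E; lra.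
Qed.

Let clash_me : clashes w m e t1.
Proof. by split=> //; [natlia|rewrite pos_m pos_e; have := t1E; lra]. Qed.

(** By [Lv], the particles of [v] stay behind this line, so the trap does not disturb them. *)
Let ge_m j t : (m <= j)%N -> alive w j t -> m%:R + b * t <= ps w j t.
Proof.
move=> mj aj; have t0 := al_ge0 dw aj; have je := le_e aj.
have bzt : b * t <= z * t by rewrite ler_wpM2r // ltW.
move: je; rewrite leq_eqVlt => /predU1P[->|je]; first by rewrite pos_e; have := @ler0n R n.*2.+1; lra.
move: mj; rewrite leq_eqVlt => /predU1P[<-|mj]; first by rewrite pos_m; lra.
by have [] := inner (k := j) ltac:(natlia) aj; lra.
Qed.

Let alive_v k t : (k < m)%N -> (alive w k t <-> alive v k t).
Proof.
move=> km; apply: (ballistic_compare (Z := fun k _ => (k < m)%N) (vel_finite w)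
  (vel_finite v) dw (aliveP v)) => //.
- clear k t km => k t km; rewrite wv // sv sw; split=> //; split=> // _; natlia.
- clear k t km => k j t r km r0 rt kE [C|[_ _ /(al_in (aliveP v)) + _]]; last by rewrite sv.
  rewrite ltnNge; apply/negP => mj; have [_ ak aj E] := C.
  have := (last_survivesP _ _).1 Lv _ _ (kE.1 ak).
  by have := ge_m mj aj; rewrite -E /pos wv // sv; lra.
Qed.

Let swR : (size w)%:R = m%:R + n.*2.+1%:R + 1 :> R.
Proof. by rewrite sw -natr1 eE natrD. Qed.

(** Up to [t1] no particle is ahead of the final [b] of the trap, which is parallel to the new [b].
    After [t1] the first [z] and the final [b] are gone, [inner] bounds the rest of the trap, and
    [Lv] bounds the particles of [v]. *)
Lemma after_last_survives : last_survives w b.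
Proof.
apply/last_survivesP => k t ak; have t0 := al_ge0 dw ak; have ke := le_e ak.
have eN : ps w e t < (size w)%:R + b * t by rewrite pos_e swR; lra.
have [tt|tt] := leP t t1.
  apply: le_lt_trans eN; apply: al_lepos dw _ _ _ ak _ ke.
  exact: al_le dw _ _ _ alive_e t0 tt.
have [km|mk] := ltnP k m.
  have := (last_survivesP _ _).1 Lv _ _ ((alive_v _ km).1 ak).
  by rewrite /pos wv // sv swR; have := @ler0n R n.*2.+1; lra.
move: ke; rewrite leq_eqVlt => /predU1P[E|ke].
  by exfalso; rewrite E in ak; exact: al_clash dw _ _ _ _ ak tt (clash_sym clash_me).
move: mk; rewrite leq_eqVlt => /predU1P[E|mk].
  by exfalso; rewrite -E in ak; exact: al_clash dw _ _ _ _ ak tt clash_me.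
by have [_ + _] := inner (k := k) ltac:(natlia) ak; move/lt_trans; apply.
Qed.

Let t2 : R := (b - a)^-1.
Let t2E : (b - a) * t2 = 1.
Proof. by rewrite mulfV // subr_eq0 gt_eqF. Qed.

(** Hypothesis [hn] says exactly that [t2 <= t1]: an [a] fired next reaches the final [b] no later
    than the first [z] does. *)
Let alive_e2 : alive w e t2.
Proof.
have t20 : 0 <= t2 by rewrite invr_ge0 subr_ge0 ltW.
apply: al_le dw _ _ _ alive_e t20 _; rewrite /t1 ler_pdivlMr ?subr_gt0 // mulrC.
by rewrite -ler_pdivlMr ?invr_gt0 ?subr_gt0 // invrK.
Qed.

Lemma after_not_last_survives : ~ last_survives w a.
Proof.
move=> /last_survivesP/(_ _ _ alive_e2); rewrite pos_e swR; have := t2E; lra.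
Qed.

(** The final [b] does not outlive [t1], so the hit [b] would start further left. But the additional
    [a] meets the final [b] by time [t2], before it can reach any earlier [b]. *)
Lemma after_not_hit u x : w = u ++ b :: x -> {subset x <= S} -> ~ hit_by_next a b u x.
Proof.
move=> wE xS hit; have [t C] := hit_clash a_min b_snd aS bS ab xS hit.
have surv := hit_survives hit; rewrite -wE in C surv.
have uw : (size u < size w)%N by rewrite wE size_cat /=; natlia.
have ue : (size u < e)%N.
  move: uw; rewrite sw ltnS leq_eqVlt => /predU1P[E|//]; exfalso.
  have := surv (t1 + 1) ltac:(have := t1_ge0; lra); rewrite E => al.
  by apply: (al_clash dw al _ (clash_sym clash_me)); lra.
have [_ _ /alive_last[_ H] E] := C.
have tt2 : t <= t2.
  by rewrite leNgt; apply/negP => /H/(_ alive_e2); rewrite pos_e swR; have := t2E; lra.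
move: E; rewrite -cats1 pos_catl // /pos /vel nth_cat ltnn subnn /=.
rewrite wE nth_cat ltnn subnn /= -wE swR => E.
have : (b - a) * t <= (b - a) * t2 by rewrite ler_wpM2l // subr_ge0 ltW.
have : (size u)%:R + 1 <= m%:R + n.*2.+1%:R :> R by rewrite natr1 -natrD ler_nat -eE.
have := t2E; lra.
Qed.

End after.

Section trap_facts.
Variables (v : seq R) (n : nat).
Hypotheses (vS : {subset v <= S}) (Lv : last_survives v b).
Hypothesis hn : z - b <= n.*2.+1%:R * (b - a).

Let wS : {subset v ++ trap n <= S}.
Proof. by apply/sub_cat; split=> //; exact: trap_sub. Qed.

Let sw : size (v ++ trap n) = (size v + n.*2.+1).+1.
Proof. by rewrite size_cat size_trap addnS. Qed.

Let wv k : (k < size v)%N -> vel (v ++ trap n) k = vel v k.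
Proof. by move=> kv; rewrite /vel nth_cat kv. Qed.

Let vel_w k : (k < n.*2.+2)%N -> vel (v ++ trap n) (size v + k) =
  if k == n.*2.+1 then b else if (k == 0) || odd k then z else a.
Proof. by move=> kn; rewrite /vel nth_cat ltnNge leq_addr /= addKn nth_mkseq. Qed.

Lemma trap_last_survives : last_survives (v ++ trap n) b.
Proof. exact: (after_last_survives wS Lv erefl sw erefl wv vel_w). Qed.

Lemma trap_not_last_survives : ~ last_survives (v ++ trap n) a.
Proof. exact: (after_not_last_survives wS hn erefl sw erefl vel_w). Qed.

Lemma trap_not_hit u x : v ++ trap n = u ++ b :: x -> ~ hit_by_next a b u x.
Proof.
move=> E; apply: (after_not_hit wS hn erefl sw erefl vel_w E).
by move: wS; rewrite E => /sub_cat[_ /sub_cons[]].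
Qed.

End trap_facts.
End trap.

(** * Averages over random words *)

Section average.
Variable R : realType.
Implicit Types (S u v x : seq R) (f g : seq R -> R) (c : R).

(** The expectation of [f] over words of [N] independent uniform letters of [S], obtained by
    conditioning on the first letter. *)
Fixpoint avg S N f : R :=
  if N is M.+1 then (size S)%:R^-1 * \sum_(c <- S) avg S M (fun v => f (c :: v))
  else f [::].

Lemma avg_le S N f g :
  (forall v, {subset v <= S} -> size v = N -> f v <= g v) -> avg S N f <= avg S N g.
Proof.
elim: N f g => [|N IH] f g fg /=; first exact: fg.
rewrite ler_wpM2l ?invr_ge0 // big_seq [leRHS]big_seq ler_sum // => c cS.
by apply: IH => v vS vN; apply: fg; rewrite /= ?vN //; exact/sub_cons.
Qed.

Lemma avg_eq S N f g :
  (forall v, {subset v <= S} -> size v = N -> f v = g v) -> avg S N f = avg S N g.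
Proof.
by move=> fg; apply/le_anti; rewrite !avg_le // => v vS vN; rewrite fg.
Qed.

Lemma avgM S N k f : avg S N (fun v => k * f v) = k * avg S N f.
Proof.
elim: N f => [//|N IH] f /=; rewrite mulrCA; congr (_ * _).
by rewrite mulr_sumr; apply: eq_bigr => c _; exact: IH.
Qed.

Lemma avgMr S N k f : avg S N (fun v => f v * k) = avg S N f * k.
Proof. by rewrite mulrC -avgM; apply: avg_eq => v _ _; exact: mulrC. Qed.

Lemma avgD S N f g : avg S N (fun v => f v + g v) = avg S N f + avg S N g.
Proof.
elim: N f g => [//|N IH] f g /=; rewrite -mulrDr; congr (_ * _).
by rewrite -big_split; apply: eq_bigr => c _; exact: IH.
Qed.

Lemma avgB S N f g : avg S N (fun v => f v - g v) = avg S N f - avg S N g.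
Proof.
rewrite -[- avg S N g]mulN1r -avgM -avgD.
by apply: avg_eq => v _ _; rewrite mulN1r.
Qed.

Lemma avg0 S N : avg S N (fun _ => 0) = 0.
Proof.
by elim: N => [//|N IH] /=; rewrite big1 ?mulr0.
Qed.

Lemma avg_sum S N I (s : seq I) (F : I -> seq R -> R) :
  avg S N (fun v => \sum_(i <- s) F i v) = \sum_(i <- s) avg S N (F i).
Proof.
elim: s => [|i s IH]; last rewrite big_cons -IH -avgD.
  by rewrite big_nil -[RHS](avg0 S N); apply: avg_eq => v _ _; rewrite big_nil.
by apply: avg_eq => v _ _; rewrite big_cons.
Qed.

Lemma avg_cat S N M f :
  avg S (N + M) f = avg S N (fun u => avg S M (fun v => f (u ++ v))).
Proof.
elim: N f => [//|N IH] f /=; congr (_ * _); apply: eq_bigr => c _.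
by rewrite IH.
Qed.

Lemma avg_rcons S N f :
  avg S N.+1 f = avg S N (fun v => (size S)%:R^-1 * \sum_(c <- S) f (rcons v c)).
Proof.
rewrite -addn1 avg_cat; apply: avg_eq => v _ _ /=; congr (_ * _).
by apply: eq_bigr => c _; rewrite cats1.
Qed.

Lemma avg_mirror S N f :
  avg [seq - c : R | c : R <- S] N f = avg S N (fun v => f (mirror v)).
Proof.
elim: N f => [//|N IH] f; rewrite avg_rcons IH size_map avgM avg_sum /=.
congr (_ * _); rewrite big_map; apply: eq_bigr => c _.
by apply: avg_eq => v _ _; rewrite mirror_cons.
Qed.

Lemma avg_const S N k : S != [::] -> avg S N (fun _ => k) = k.
Proof.
move=> S0; have n0 : (size S)%:R != 0 :> R by rewrite pnatr_eq0 size_eq0.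
elim: N => [//|N IH] /=.
rewrite (eq_bigr (fun _ => k)); last by move=> c _; exact: IH.
by rewrite big_const_seq count_predT iter_addr_0 -[k *+ _]mulr_natl mulKf.
Qed.

Lemma avg_ge0 S N f : (forall v, {subset v <= S} -> size v = N -> 0 <= f v) -> 0 <= avg S N f.
Proof. by move=> f0; rewrite -(avg0 S N); exact: avg_le. Qed.

Lemma avg_ge_word S s f : {subset s <= S} ->
  (forall v, {subset v <= S} -> size v = size s -> 0 <= f v) ->
  (size S)%:R^-1 ^+ size s * f s <= avg S (size s) f.
Proof.
elim: s f => [|c s IH] f sS f0 /=; first by rewrite expr0 mul1r.
have [cS {}sS] := (sub_cons _ _ _).1 sS.
rewrite exprS -mulrA ler_wpM2l ?invr_ge0 //.
have f0' e : e \in S -> forall v, {subset v <= S} -> size v = size s -> 0 <= f (e :: v).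
  by move=> eS v vS vs; apply: f0; rewrite /= ?vs //; exact/sub_cons.
rewrite (big_rem c) //= -[leLHS]addr0 lerD ?IH //; first exact: f0'.
rewrite big_seq sumr_ge0 // => e /mem_rem eS; apply: avg_ge0; exact: f0'.
Qed.

Definition ind (P : Prop) : R := (`[< P >] : nat)%:R.

Lemma ind_true P : P -> ind P = 1.
Proof. by move=> p; rewrite /ind; have /asboolP -> := p. Qed.

Lemma ind_false P : ~ P -> ind P = 0.
Proof. by move=> p; rewrite /ind; have /asboolPn/negPf -> := p. Qed.

Lemma ind_ge0 P : 0 <= ind P.
Proof. exact: ler0n. Qed.

Lemma ind_le1 P : ind P <= 1.
Proof. by rewrite /ind; case: asbool. Qed.

Lemma ind_le P Q : (P -> Q) -> ind P <= ind Q.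
Proof.
move=> PQ; have [p|p] := pselect P; last by rewrite (ind_false p) ind_ge0.
by rewrite !ind_true //; exact: PQ.
Qed.

Lemma ind_iff P Q : (P <-> Q) -> ind P = ind Q.
Proof. by move=> [PQ QP]; apply/le_anti; rewrite !ind_le. Qed.

Lemma ind_and P Q : ind (P /\ Q) = ind P * ind Q.
Proof. by rewrite /ind asbool_and -mulnb natrM. Qed.

Lemma ind_diff P Q : (Q -> P) -> ind (P /\ ~ Q) = ind P - ind Q.
Proof.
move=> QP; have [p|np] := pselect P; last first.
  have nq : ~ Q by move/QP.
  by rewrite (ind_false np) (ind_false nq) subrr; apply: ind_false => -[].
have [q|nq] := pselect Q.
  by rewrite (ind_true p) (ind_true q) subrr; apply: ind_false => -[].
by rewrite (ind_true p) (ind_false nq) subr0; apply: ind_true.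
Qed.

End average.

(** * A renewal argument for real sequences *)

Section renewal.
Variable R : realType.
Implicit Types (r a q : nat -> R) (N K m : nat).

(** At most [m0] terms involve [a] at an index below [m0], and each of them is at most 1. *)
Let sum_le_count a m0 N : (forall m, 0 <= a m <= 1) -> forall d, (forall m, (m0 <= m)%N -> a m <= d) -> 0 <= d ->
  forall r, (forall j, 0 <= r j <= 1) ->
  \sum_(j < N) r j * a (N - j.+1)%N <= d * (\sum_(j < N) r j) + m0%:R.
Proof.
move=> a01 d ad d0 r r01.
have: \sum_(j < N) r j * a (N - j.+1)%N <= \sum_(j < N) (d * r j + (N - j.+1 < m0)%N%:R).
  apply: ler_sum => j _; have /andP[r0 r1] := r01 j; have /andP[a0 a1] := a01 (N - j.+1)%N.
  have [lt|ge] := ltnP; last by rewrite addr0 mulrC ler_wpM2r ?ad.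
  have : r j * a (N - j.+1)%N <= 1 by rewrite mulr_ile1.
  by have := mulr_ge0 d0 r0; rewrite /=; lra.
move=> /le_trans; apply; rewrite big_split /= -mulr_sumr lerD2l -natr_sum ler_nat.
rewrite (reindex_inj rev_ord_inj) /=.
rewrite (eq_bigr (fun j : 'I_N => ((j < m0)%N : nat))); last first.
  by move=> j _; congr (nat_of_bool (_ < m0)%N); have := ltn_ord j; lia.
suff -> : forall M, \sum_(j < M) ((j < m0)%N : nat) = minn M m0 by rewrite geq_minr.
elim=> [|M IH]; first by rewrite big_ord0 min0n.
by rewrite big_ord_recr /= IH; lia.
Qed.

(* If [a] tended to 0, the gain hypothesis would bound the partial sums of [r],
   so that the convolution of [r] and [a] would tend to 0 and exceed [eps]. *)
Lemma renewal_lower_bound r a q K eps :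
  (forall j, 0 <= r j <= 1) -> r 0 = 1 -> (forall m, 0 <= a m <= 1) ->
  (forall m, a m.+1 <= a m) -> (forall j, 0 <= q j) -> 0 < eps ->
  let G N := \sum_(j < N) r j * a (N - j.+1)%N - \sum_(j < N) q j in
  (forall N, G N <= G N.+1) -> (forall k, eps * r k <= G (k + K).+1 - G (k + K)%N) ->
  exists2 delta, 0 < delta & forall m, delta <= a m.
Proof.
move=> r01 r0 a01 a_dec q0 eps0 G G_inc G_gain.
have [//|/forall2NP nex] := pselect (exists2 delta, 0 < delta & forall m, delta <= a m).
exfalso.
have a_le m m' : (m <= m')%N -> a m' <= a m.
  move=> /subnK <-; elim: (m' - m)%N => [//|i]; rewrite addSn; exact/le_trans.
have small d : 0 < d -> exists m0, forall m, (m0 <= m)%N -> a m <= d.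
  move=> d0; case: (nex d) => [//|/existsNP[m0 /negP]]; rewrite -ltNge => am0.
  by exists m0 => m mm; apply: le_trans (ltW am0); exact: a_le.
pose T N := \sum_(j < N) r j.
have TS N : T N.+1 = T N + r N by rewrite /T big_ord_recr.
have G_ge0 N : 0 <= G N.
  elim: N => [|N IH]; last exact: le_trans (G_inc N).
  by rewrite /G !big_ord0 subrr.
have GT N : eps * T N <= G (N + K)%N.
  elim: N => [|N IH]; last by rewrite TS addSn; have := G_gain N; lra.
  by rewrite /T big_ord0 mulr0 add0n.
have G_le N : G N <= \sum_(j < N) r j * a (N - j.+1)%N.
  by rewrite /G lerBlDr lerDl sumr_ge0.
have [m0 am0] := small (eps / 2) ltac:(lra).
have TK N k : T (N + k)%N <= T N + k%:R.
  elim: k => [|k IH]; first by rewrite addn0 addr0.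
  by rewrite addnS TS -natr1; have /andP[_ ?] := r01 (N + k)%N; lra.
(* From [m0] on, [a] is at most [eps / 2], so [eps * T N <= G (N + K) <= eps / 2 * T (N + K) + m0];
   as [T (N + K) <= T N + K], half of the left-hand side absorbs the term in [T N]. *)
have T_bounded N : T N <= K%:R + 2 / eps * m0%:R.
  have h1 := GT N; have h2 := G_le (N + K)%N.
  have h3 := sum_le_count (N + K)%N a01 am0 ltac:(lra) r01.
  have h4 : eps / 2 * T (N + K)%N <= eps / 2 * (T N + K%:R) by rewrite ler_wpM2l ?TK //; lra.
  have h5 : eps * T N <= eps * (K%:R + 2 / eps * m0%:R).
    rewrite mulrDr mulrA (_ : eps * (2 / eps) = 2); last by rewrite mulrCA mulfV ?mulr1 // gt_eqF.
    by move: h3; rewrite -/(T _); lra.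
  by rewrite ler_pM2l in h5.
have T_inc N N' : (N <= N')%N -> T N <= T N'.
  move=> /subnK <-; elim: (N' - N)%N => [//|i IH].
  by rewrite addSn TS; have /andP[? _] := r01 (i + N)%N; lra.
have [J TJ] : exists J, forall N, T N <= T J + eps / 4.
  pose A := [set T N | N in [set: nat]].
  have supA : has_sup A.
    split; first by exists (T 0), 0.
    by exists (K%:R + 2 / eps * m0%:R) => _ [N _ <-].
  have e4 : 0 < eps / 4 by lra.
  have [_ [J _ <-] TJ] := sup_adherent e4 supA; exists J => N.
  by have := ub_le_sup supA.2 (ex_intro2 _ _ N I erefl : A (T N)); lra.
(* The tail of the sum of [r] beyond [J] is at most [eps / 4], and [m1] bounds the first [J] terms
   of the convolution likewise. [J.+1] avoids a zero denominator. *)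
have [m1 am1] := small (eps / 4 / J.+1%:R) ltac:(rewrite divr_gt0 // ; lra).
(* For this [N] the first [J] terms involve [a] only at indices at least [m1], and [1 + K <= N]
   yields [eps <= G N]. *)
pose N := (m1 + J + K).+1.
have GN : eps <= G N.
  have := GT 1%N; rewrite /T big_ord_recl big_ord0 addr0 r0 mulr1 => /le_trans; apply.
  have : (1 + K <= N)%N by rewrite /N; lia.
  move=> /subnK <-; elim: (N - _)%N => [//|i /le_trans]; rewrite addSn; exact.
have := le_trans GN (G_le N); apply/negP; rewrite -ltNge.
have -> : N = (J + (N - J))%N by rewrite /N; lia.
rewrite big_split_ord /=.
have h1 : \sum_(i < J) r i * a (J + (N - J) - i.+1)%N <= eps / 4.
  apply: (@le_trans _ _ (\sum_(i < J) eps / 4 / J.+1%:R)).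
    apply: ler_sum => i _; have /andP[ri0 ri1] := r01 i.
    have ai := am1 (J + (N - J) - i.+1)%N ltac:(rewrite /N; have := ltn_ord i; lia).
    have /andP[ai0 _] := a01 (J + (N - J) - i.+1)%N.
    exact: le_trans (ler_piMl ai0 ri1) ai.
  rewrite sumr_const card_ord -[_ *+ J]mulr_natr -mulrA ger_pMr; last by lra.
  by rewrite mulrC ler_pdivrMr // mul1r ler_nat.
have h2 : \sum_(i < N - J) r (J + i)%N * a (J + (N - J) - (J + i).+1)%N <= eps / 4.
  apply: (@le_trans _ _ (\sum_(i < N - J) r (J + i)%N)).
    apply: ler_sum => i _; have /andP[ri0 _] := r01 (J + i)%N.
    by have /andP[_ ?] := a01 (J + (N - J) - (J + i).+1)%N; rewrite ler_piMr.
  have := TJ (J + (N - J))%N; rewrite {1}/T big_split_ord /= -/(T J); lra.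
lra.
Qed.

End renewal.

(** * The second slowest particle *)

Section second_slowest.
Variable R : realType.
Implicit Types (u v x : seq R) (c t : R) (j k : nat).

Variables (S : seq R) (a b z : R).
Hypotheses (a_min : {in S, forall c, a <= c}) (b_snd : {in S, forall c, c < b -> c = a}).
Hypotheses (z_max : {in S, forall c, c <= z}) (S_uniq : uniq S).
Hypotheses (aS : a \in S) (bS : b \in S) (zS : z \in S) (ab : a < b) (bz : b < z).

Let hit_at v j : Prop := vel v j = b /\ hit_by_next a b (take j v) (drop j.+1 v).

(* [balance v / size S] is the expected increase of the number of surviving
   particles [b] minus the number of surviving particles [a] when a random
   particle is fired after the word [v]. *)
Let balance v : R :=
  ind R (last_survives v b) - ind R (last_survives v a) - \sum_(j < size v) ind R (hit_at v j).

Let sub_drop v j : {subset v <= S} -> {subset drop j v <= S}.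
Proof. by move=> vS e /mem_drop/vS. Qed.

Lemma hit_at_split v j : (j < size v)%N -> hit_at v j ->
  v = take j v ++ b :: drop j.+1 v.
Proof. by move=> jv [<- _]; exact: split_nth. Qed.

(* Where [a] survives or destroys a surviving [b], the particle [b] fired in its
   place survives; and [a] destroys at most one particle [b]. *)
Let balance_ge0 v : {subset v <= S} -> 0 <= balance v.
Proof.
move=> vS; rewrite /balance.
have [[j hj]|nohit] := pselect (exists j : 'I_(size v), hit_at v j).
  have jE := hit_at_split (ltn_ord j) hj; have [_ hit] := hj.
  have dS := @sub_drop v j.+1 vS.
  have Lb := hit_last_survives a_min b_snd aS bS ab dS hit.
  have nLa := hit_not_last_survives a_min b_snd aS bS ab dS hit.
  rewrite -jE in Lb nLa; rewrite (ind_true R Lb) (ind_false R nLa) (bigD1 j) //=.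
  rewrite (ind_true R hj) big1; first by lra.
  move=> i ij; apply: ind_false => hi; move/negP: ij; apply; apply/eqP/val_inj => /=.
  have iE := hit_at_split (ltn_ord i) hi; have [_ hit'] := hi.
  have := hit_unique a_min b_snd aS bS ab (@sub_drop v i.+1 vS) dS _ hit' hit.
  by rewrite -iE -jE !size_takel ?(ltnW (ltn_ord _)) //; exact.
rewrite big1 ?subr0; last first.
  by move=> i _; apply: ind_false => hi; apply: nohit; exists i.
by rewrite subr_ge0 ind_le //; apply: last_survives_le; exact: ltW.
Qed.

(** When [b] survives after [v], it also does after the trap, whereas an [a] fired there dies
    without hitting a surviving [b]: the balance is 1. Otherwise [balance_ge0] suffices. *)
Let trap_balance v n : {subset v <= S} -> z - b <= n.*2.+1%:R * (b - a) ->
  ind R (last_survives v b) <= balance (v ++ trap a b z n).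
Proof.
move=> vS hn; have [Lv|nLv] := pselect (last_survives v b); last first.
  rewrite (ind_false R nLv) balance_ge0 //; apply/sub_cat; split=> //.
  exact: trap_sub.
have Lb : last_survives (v ++ trap a b z n) b.
  exact: (trap_last_survives a_min z_max aS bS zS ab bz).
have nLa := trap_not_last_survives a_min z_max aS bS zS ab bz vS hn.
rewrite /balance (ind_true R Lv) (ind_true R Lb) (ind_false R nLa) big1 ?subr0 //.
move=> j _; apply: ind_false => hj; have [_ hit] := hj.
exact: (trap_not_hit a_min b_snd z_max aS bS zS ab bz vS hn (hit_at_split (ltn_ord j) hj) hit).
Qed.

Let size_S : (size S)%:R != 0 :> R.
Proof. by rewrite pnatr_eq0 size_eq0; apply/eqP => E; move: aS; rewrite E. Qed.

Let S_neq0 : S != [::].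
Proof. by apply/eqP => E; move: aS; rewrite E. Qed.

Let r N : R := avg S N (fun v => ind R (last_survives v b)).
Let q N : R := avg S N (fun v => ind R (last_survives v a)).
Let p N : R := avg S N (fun v => ind R (first_survives b v)).
Let loss x : R := ind R (first_survives b x /\ ~ first_survives b (rcons x a)).

Let avg_ind01 N (P : seq R -> Prop) : 0 <= avg S N (fun v => ind R (P v)) <= 1.
Proof.
rewrite avg_ge0 /=; last by move=> v _ _; exact: ind_ge0.
rewrite -[leRHS](avg_const N 1 S_neq0); apply: avg_le => v _ _; exact: ind_le1.
Qed.

(** Among the possible next letters only [a] can end the survival of [b]. *)
Let p_decr N : p N - p N.+1 = (size S)%:R^-1 * avg S N loss.
Proof.
rewrite /p avg_rcons -avgB -avgM; apply: avg_eq => v vS _.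
apply: (mulfI size_S); rewrite mulrBr !mulVKf //.
have -> : (size S)%:R * ind R (first_survives b v) = \sum_(c <- S) ind R (first_survives b v).
  by rewrite big_const_seq count_predT iter_addr_0 mulr_natl.
rewrite -sumrB (bigD1_seq a) //= big1_seq ?addr0 => [|c /andP[ca cS]]; last first.
  by rewrite (ind_iff R (first_b_rcons_neq a_min b_snd aS bS vS cS ca)) subrr.
by rewrite /loss ind_diff //; exact: (first_b_rcons a_min b_snd aS bS vS aS).
Qed.

(** The particle at index [j] separates two independent sides; the probability [(size S)%:R^-1] that
    its letter is [b] is the factor of [p_decr]. *)
Let avg_hit j M : avg S (j + M.+1) (fun v => ind R (hit_at v j)) = r j * (p M - p M.+1).
Proof.
rewrite p_decr avg_cat /r -mulrC -avgM; apply: avg_eq => u uS uj /=.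
rewrite -mulrA; congr (_ * _).
rewrite (bigD1_seq b) //= big1_seq ?addr0 => [|c /andP[cb cS]]; last first.
  rewrite -[RHS](avg0 S M); apply: avg_eq => x _ _; apply: ind_false => -[].
  by rewrite -uj vel_cat_mid => e; rewrite e eqxx in cb.
rewrite mulrC -avgM; apply: avg_eq => x _ _; rewrite /loss -ind_and; apply: ind_iff.
rewrite /hit_at /hit_by_next -uj vel_cat_mid take_size_cat // drop_cat ltnNge leqnSn subSnn /= drop0.
by split=> [[_ []]|[? []]].
Qed.

(** In [renewal_lower_bound], [G N] becomes [size S] times the expected number of surviving [b]
    minus that of surviving [a] among [N] particles, since only the left side can destroy an [a]. *)
Lemma second_slowest_survives : exists2 delta, 0 < delta &
  forall N, delta <= avg S N (fun v => ind R (first_survives b v)).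
Proof.
have [n hn] : exists n, z - b <= n.*2.+1%:R * (b - a).
  exists (Num.truncn ((z - b) / (b - a))).+1.
  have ba : 0 < b - a by rewrite subr_gt0.
  rewrite -ler_pdivrMr //; apply: ltW; apply: (@lt_le_trans _ _ _ _ _ (truncnS_gt _)).
  by rewrite ler_nat; move: (Num.truncn _) => t; lia.
have eps0 : 0 < (size S)%:R^-1 ^+ n.*2.+2 :> R.
  by rewrite exprn_gt0 // invr_gt0 lt_neqAle eq_sym size_S ler0n.
(* The increment of [G] is the average balance: [r N * p 0 - q N] accounts for the new particle
   itself, and the differences of [p] for the particles [b] that it hits. *)
have gain N : \sum_(j < N.+1) r j * p (N.+1 - j.+1)%N - \sum_(j < N.+1) q j
    - (\sum_(j < N) r j * p (N - j.+1)%N - \sum_(j < N) q j) = avg S N balance.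
  have -> : avg S N balance = r N - q N - \sum_(j < N) r j * (p (N - j.+1)%N - p (N - j.+1).+1).
    rewrite /r /q -avgB; transitivity (avg S N (fun v => ind R (last_survives v b)
        - ind R (last_survives v a) - \sum_(j < N) ind R (hit_at v j))).
      by apply: avg_eq => v _ vN; rewrite /balance vN.
    rewrite avgB; congr (_ - _); rewrite avg_sum; apply: eq_bigr => j _.
    rewrite -avg_hit (_ : (j + (N - j.+1).+1)%N = N) //.
    by have := ltn_ord j; lia.
  rewrite !big_ord_recr /= subnn.
  have -> : p 0 = 1.
    rewrite /p /= (ind_true R) // => t t0.
    have [//|nal] := pselect (alive [:: b] 0 t); exfalso.
    have [s [j [_ [ne0 _ /(al_in (aliveP _)) + _]]]] := al_die (aliveP [:: b]) (k := 0) isT t0 nal.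
    by case: j ne0.
  have E : \sum_(j < N) r j * p (N.+1 - j.+1)%N - \sum_(j < N) r j * p (N - j.+1)%N
      = - \sum_(j < N) r j * (p (N - j.+1)%N - p (N - j.+1).+1).
    rewrite -sumrB -sumrN; apply: eq_bigr => j _.
    by rewrite subSS subnSK // -mulrBr -mulrN opprB.
  by rewrite mulr1; lra.
apply: (@renewal_lower_bound R r p q n.*2.+2 ((size S)%:R^-1 ^+ n.*2.+2)) => //.
- by move=> j; exact: avg_ind01.
- rewrite /r /= (ind_true R) //; apply/last_survivesP => k t /(al_in (aliveP _)).
  by [].
- by move=> m; exact: avg_ind01.
- by move=> m; rewrite -subr_ge0 p_decr mulr_ge0 ?invr_ge0 //; apply: avg_ge0 => v _ _; exact: ind_ge0.
- by move=> j; have /andP[] := avg_ind01 j (fun v => last_survives v a).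
- by move=> N; rewrite -subr_ge0 gain; apply: avg_ge0 => v vS _; exact: balance_ge0.
(* The trap follows the first [k] letters with probability [(size S)%:R^-1 ^+ n.*2.+2], and every
   other completion has a nonnegative balance. *)
- move=> k; rewrite gain avg_cat /r -avgM; apply: avg_le => v vS _.
  have bal u : {subset u <= S} -> 0 <= balance (v ++ u).
    by move=> uS; apply: balance_ge0; exact/sub_cat.
  have tS : {subset trap a b z n <= S} by exact: trap_sub.
  have := @avg_ge_word R S (trap a b z n) (fun u => balance (v ++ u))
    tS (fun u uS _ => bal u uS).
  rewrite size_trap => /(le_trans _); apply; rewrite ler_pM2l //.
  exact: trap_balance.
Qed.

End second_slowest.

(** * The fastest particle *)

Section fastest.
Variable R : realType.
Implicit Types (u v x : seq R) (c t : R) (j k : nat).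

Lemma nonincreasing_stable (f : nat -> R) (eps : R) : 0 < eps -> (forall m, 0 <= f m) ->
  (forall m, f m.+1 <= f m) -> exists M, forall m, (M <= m)%N -> f M - f m <= eps.
Proof.
move=> eps0 f0 f_dec; pose A := [set f m | m in [set: nat]].
have infA : has_inf A by split; [exists (f 0), 0|exists 0 => _ [m _ <-]].
have [_ [M _ <-] fM] := inf_adherent eps0 infA; exists M => m _.
by have := ge_inf infA.2 (ex_intro2 _ _ m I erefl : A (f m)); lra.
Qed.

Section prefix.
Variables (S : seq R) (a z : R).
Hypotheses (a_min : {in S, forall c, a <= c}) (z_max : {in S, forall c, c <= z}).

(** A particle starting beyond [c :: u] is more than [size u] away from the first one, and distances
    shrink at rate at most [z - a]. *)
Lemma alive_prefix c u x t : c \in S -> {subset u <= S} -> {subset x <= S} ->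
  0 <= t -> (z - a) * t <= (size u)%:R ->
  alive (c :: u ++ x) 0 t <-> alive (c :: u) 0 t.
Proof.
move=> cS uS xS t0 tu.
have wS : {subset c :: u ++ x <= S} by apply/sub_cons; split=> //; exact/sub_cat.
apply: (@alive_cone R _ _ _ _ a _ _ (vel_finite _) (aliveP (c :: u ++ x))) => //.
- move=> k; rewrite /= ltnS leq_eqVlt => ku; split.
    by rewrite size_cat; lia.
  by case: k ku => [|k] //= ku; rewrite /vel /= nth_cat ifT //; lia.
- by move=> k kw; apply: a_min; exact: vel_in.
- rewrite /pos /vel /= -natr1.
  have : (z - c) * t >= 0 by rewrite mulr_ge0 // subr_ge0 z_max.
  lra.
Qed.

End prefix.

Variables (S : seq R) (a y z : R).
Hypotheses (a_min : {in S, forall c, a <= c}) (z_max : {in S, forall c, c <= z}).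
Hypotheses (y_snd : {in S, forall c, y < c -> c = z}) (S_uniq : uniq S).
Hypotheses (aS : a \in S) (yS : y \in S) (zS : z \in S) (ay : a < y) (yz : y < z).

(** Reflection turns the two largest velocities [y < z] into the two smallest, [- z < - y], to which
    the results on the second slowest particle apply. *)
Let S' := [seq - c : R | c : R <- S].

Let in_S' c : (c \in S') = (- c \in S).
Proof. by rewrite -{1}[c]opprK mem_map //; exact: oppr_inj. Qed.

Let z'_min : {in S', forall c, - z <= c}.
Proof. by move=> c; rewrite in_S' => /z_max; rewrite lerNl. Qed.

Let y'_snd : {in S', forall c, c < - y -> c = - z}.
Proof. by move=> c; rewrite in_S' => /y_snd h; rewrite ltrNr => /h <-; rewrite opprK. Qed.

Let a'_max : {in S', forall c, c <= - a}.
Proof. by move=> c; rewrite in_S' => /a_min; rewrite lerNr. Qed.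

Let yS' : - y \in S'. Proof. by rewrite in_S' opprK. Qed.
Let zS' : - z \in S'. Proof. by rewrite in_S' opprK. Qed.
Let aS' : - a \in S'. Proof. by rewrite in_S' opprK. Qed.

Let mirror_sub v : {subset v <= S} -> {subset mirror v <= S'}.
Proof. by move=> vS _ /mapP[c cv ->]; rewrite in_S' opprK; apply: vS; rewrite -mem_rev. Qed.

Let last_mirror v : first_survives (- y) (mirror v) <-> last_survives v y.
Proof. by rewrite first_survives_mirror mirrorK opprK. Qed.

Let r N : R := avg S N (fun v => ind R (last_survives v y)).

Let r_lower : exists2 rho, 0 < rho & forall N, rho <= r N.
Proof.
have S'u : uniq S' by rewrite map_inj_uniq //; exact: oppr_inj.
have [||rho rho0 H] := second_slowest_survives z'_min y'_snd a'_max S'u zS' yS' aS'.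
- by rewrite ltrN2.
- by rewrite ltrN2.
exists rho => // N; apply: (le_trans (H N)); rewrite avg_mirror; apply: avg_le => v _ _.
by rewrite (ind_iff R (last_mirror v)).
Qed.

Let last_cons c v : c \in S -> {subset v <= S} -> last_survives (c :: v) y -> last_survives v y.
Proof.
move=> cS vS /last_mirror H; apply/last_mirror.
apply: (first_b_rcons z'_min y'_snd zS' yS' (mirror_sub vS) (c := - c)).
  by rewrite in_S' opprK.
by rewrite -mirror_cons.
Qed.

Let last_cat u v : {subset u <= S} -> {subset v <= S} -> last_survives (u ++ v) y -> last_survives v y.
Proof.
elim: u => [//|c u IH] /sub_cons[cS uS] vS /= H.
by apply: IH => //; apply: last_cons H => //; exact/sub_cat.
Qed.

(* By this time no particle fired after the first [m + 1] can have reached the first one. *)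
Definition safe_time m : R := m%:R / (z - a).

Let za : 0 < z - a. Proof. by rewrite subr_gt0 (lt_trans ay). Qed.

Let safe_timeE m : (z - a) * safe_time m = m%:R.
Proof. by rewrite mulrC divfK // gt_eqF. Qed.

Let safe_time_ge0 m : 0 <= safe_time m.
Proof. by rewrite divr_ge0 // ltW. Qed.

Let safe_time_le m m' : (m <= m')%N -> safe_time m <= safe_time m'.
Proof. by move=> mm; rewrite ler_pM2r ?invr_gt0 // ler_nat. Qed.

(** Survival of [z] in a longer word need not imply survival in a prefix, since a later particle may
    destroy its killer; survival up to the safe time does pass to prefixes. *)
Let safe u : Prop := alive (z :: u) 0 (safe_time (size u)).
Let p N : R := avg S N (fun u => ind R (safe u)).

Let safe_cat u x : {subset u <= S} -> {subset x <= S} -> safe (u ++ x) -> safe u.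
Proof.
move=> uS xS; rewrite /safe => H.
apply/(alive_prefix a_min z_max zS uS xS) => //; first by rewrite safe_timeE.
by apply: al_le (aliveP _) _ _ _ H _ _ => //; apply: safe_time_le; rewrite size_cat leq_addr.
Qed.

Let S_gt0 : 0 < (size S)%:R :> R.
Proof. by rewrite ltr0n lt0n size_eq0; apply/eqP => E; move: aS; rewrite E. Qed.

Let S_neq0 : S != [::].
Proof. by apply/eqP => E; move: aS; rewrite E. Qed.

(** Prescribing one letter multiplies the average of a nonnegative function by at most [size S]. *)
Let avg_cons_le (f : seq R -> R) c M : c \in S ->
  (forall v, {subset v <= S} -> size v = M.+1 -> 0 <= f v) ->
  avg S M (fun v => f (c :: v)) <= (size S)%:R * avg S M.+1 f.
Proof.
move=> cS f0 /=; rewrite mulrA mulfV ?gt_eqF // mul1r (big_rem c) //= lerDl.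
rewrite big_seq sumr_ge0 // => e /mem_rem eS; apply: avg_ge0 => v vS vM.
by apply: f0; [exact/sub_cons|rewrite /= vM].
Qed.

Let stable_cat M N (P : seq R -> Prop) :
  (forall u x, {subset u <= S} -> {subset x <= S} -> P (u ++ x) -> P u) ->
  avg S M (fun u => avg S N (fun x => ind R (P u /\ ~ P (u ++ x)))) =
  avg S M (fun u => ind R (P u)) - avg S (M + N) (fun v => ind R (P v)).
Proof.
move=> Pcat; rewrite avg_cat -avgB; apply: avg_eq => u uS _.
rewrite -[X in X - _](avg_const N _ S_neq0) -avgB; apply: avg_eq => x xS _.
by rewrite ind_diff //; exact: Pcat.
Qed.

(* [z] would have overtaken [y] by the time up to which both are alive. *)
Let incompatible u u' x : {subset x <= S} ->
  (size u + size u').+2%:R <= (z - y) * safe_time (size x) ->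
  safe (u ++ u' ++ y :: x) -> safe x -> ~ last_survives (z :: u ++ u') y.
Proof.
(* The numerator exceeds the initial distance by one, so that [z] would be strictly ahead of [y] at
   time [t]. *)
move=> xS tx Hz Hx L; pose t := (size u + size u').+2%:R / (z - y).
have zy : 0 < z - y by rewrite subr_gt0.
have tE : (z - y) * t = (size u + size u').+2%:R by rewrite mulrC divfK // gt_eqF.
have t0 : 0 <= t by rewrite divr_ge0 // ltW.
have tsx : t <= safe_time (size x) by rewrite ler_pdivrMr // mulrC.
pose q := z :: u ++ u'.
have wE : z :: u ++ u' ++ y :: x = q ++ y :: x by rewrite /q /= catA.
have a0 : alive (q ++ y :: x) 0 t.
  rewrite -wE; apply: al_le (aliveP _) _ _ _ Hz t0 _; apply: (le_trans tsx).
  by apply: safe_time_le; rewrite !size_cat /= addnA addnS ltnW // ltnS leq_addl.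
have ay' : alive (q ++ y :: x) (size q) t.
  apply/alive_mid; split; first exact: L.
  (* [safe x] concerns a leading [z]; a smaller velocity [y] in its place survives as well. *)
  apply: (alive_first_le (ltW yz)); exact: al_le (aliveP _) _ _ _ Hx t0 tsx.
have := al_lepos (aliveP _) a0 ay' (leq0n _).
rewrite pos_cat_mid /pos /vel /= size_cat.
move: tE; rewrite -(@natr1 R (size u + size u').+1); lra.
Qed.

Let avg_drop M N (P : seq R -> Prop) :
  (forall u x, {subset u <= S} -> {subset x <= S} -> P (u ++ x) -> P x) ->
  avg S (M + N) (fun v => ind R (P (drop M v) /\ ~ P v)) =
  avg S N (fun x => ind R (P x)) - avg S (M + N) (fun v => ind R (P v)).
Proof.
move=> Pcat; rewrite !avg_cat -[X in X - _](avg_const M _ S_neq0) -avgB.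
apply: avg_eq => u uS uM; rewrite -avgB; apply: avg_eq => x xS _.
by rewrite -uM drop_size_cat // ind_diff //; exact: Pcat.
Qed.

Let lost_safe M M' X : avg S M (fun u => avg S M' (fun u' => avg S X (fun x =>
    ind R (safe u /\ ~ safe (u ++ u' ++ y :: x))))) <=
  (size S)%:R * (p M - p (M + (M' + X.+1))).
Proof.
rewrite -(stable_cat _ _ safe_cat) -avgM; apply: avg_le => u uS _.
rewrite [in leRHS]avg_cat -avgM; apply: avg_le => u' _ _.
by apply: (avg_cons_le (f := fun x => ind R (safe u /\ ~ safe (u ++ u' ++ x)))) => // *;
  exact: ind_ge0.
Qed.

Let lost_last M M' : avg S M (fun u => avg S M' (fun u' =>
    ind R (last_survives u' y /\ ~ last_survives (z :: u ++ u') y))) <=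
  (size S)%:R * (r M' - r (M.+1 + M')).
Proof.
pose P v := last_survives v y.
have Pcat u x : {subset u <= S} -> {subset x <= S} -> P (u ++ x) -> P x by exact: last_cat.
rewrite -(avg_drop _ _ Pcat) addSn.
apply: le_trans (avg_cons_le (f := fun v => ind R (P (drop M.+1 v) /\ ~ P v)) zS _); last first.
  by move=> *; exact: ind_ge0.
rewrite avg_cat; apply: avg_le => u _ uM; apply: avg_le => u' _ _.
by rewrite /= -uM drop_size_cat.
Qed.

(** Suppose that [p] stays above [eps]. The independent events [safe u], [last_survives u' y] and
    [safe x] hold together with probability at least [eps * rho * eps]. By [incompatible], joining
    the words spoils the first or the second event, which is rare once [p] and [r] have
    stabilised. *)
Lemma fastest_dies (eps : R) : 0 < eps ->
  exists N, avg S N (fun u => ind R (alive (z :: u) 0 (safe_time (size u)))) <= eps.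
Proof.
move=> eps0; have [//|nex] := pselect (exists N, p N <= eps); exfalso.
have pe N : eps < p N by rewrite ltNge; apply/negP => le; apply: nex; exists N.
have [rho rho0 rl] := r_lower.
(* Each of the two losses will be at most [size S * d], together half of [eps * rho * eps]. *)
pose d := eps * rho * eps / (4 * (size S)%:R).
have e0 : 0 < eps * rho * eps by rewrite !mulr_gt0.
have d0 : 0 < d by rewrite divr_gt0 // mulr_gt0.
have dE : (size S)%:R * d = eps * rho * eps / 4.
  by rewrite /d; field; exact: lt0r_neq0 S_gt0.
have ind0 N (P : seq R -> Prop) : 0 <= avg S N (fun v => ind R (P v)).
  by apply: avg_ge0 => v _ _; exact: ind_ge0.
have [M pM] : exists M, forall m, (M <= m)%N -> p M - p m <= d.
  apply: nonincreasing_stable => // m; first exact: ind0.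
  rewrite -subr_ge0 -addn1 -(stable_cat _ _ safe_cat).
  by apply: avg_ge0 => u _ _; exact: ind0.
have [M' rM] : exists M, forall m, (M <= m)%N -> r M - r m <= d.
  apply: nonincreasing_stable => // m; first exact: ind0.
  have Pcat u x : {subset u <= S} -> {subset x <= S} ->
    last_survives (u ++ x) y -> last_survives x y by exact: last_cat.
  by rewrite -subr_ge0 -add1n -(avg_drop _ _ Pcat); exact: ind0.
(* The word [x] is taken so long that its safe time lets [z] overtake [y]. *)
have [X hX] : exists X, (M + M').+2%:R <= (z - y) * safe_time X.
  have zy : 0 < z - y by rewrite subr_gt0.
  exists (Num.truncn ((M + M').+2%:R / (z - y) * (z - a))).+1.
  rewrite -ler_pdivrMl // mulrC ler_pdivlMr //; exact/ltW/truncnS_gt.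
have H : p M * r M' * p X <= (size S)%:R * (p M - p (M + (M' + X.+1))) +
    (size S)%:R * (r M' - r (M.+1 + M')).
  apply: le_trans (lerD (lost_safe M M' X) (lost_last M M')).
  have -> : p M * r M' * p X = avg S M (fun u => avg S M' (fun u' => avg S X (fun x =>
      ind R (safe u) * ind R (last_survives u' y) * ind R (safe x)))).
    rewrite -mulrA -avgMr; apply: avg_eq => u _ _.
    rewrite -[r M' * _]avgMr -avgM; apply: avg_eq => u' _ _.
    by rewrite mulrA -avgM.
  rewrite -avgD; apply: avg_le => u uS uM; rewrite -avgD; apply: avg_le => u' u'S u'M.
  rewrite -[X in _ + X](avg_const X _ S_neq0) -avgD; apply: avg_le => x xS xX.
  have [[[su lu'] sx]|nE] := pselect ((safe u /\ last_survives u' y) /\ safe x); last first.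
    by rewrite -!ind_and (ind_false R nE) addr_ge0 // ind_ge0.
  rewrite (ind_true R su) (ind_true R lu') (ind_true R sx) !mulr1.
  have [full|nfull] := pselect (safe (u ++ u' ++ y :: x)); last first.
    rewrite [X in X + _](ind_true R) // lerDl; exact: ind_ge0.
  rewrite [X in _ + X](ind_true R) ?lerDr ?ind_ge0 //; split=> //.
  by apply: incompatible full sx => //; rewrite uM u'M xX.
have nR : 0 <= (size S)%:R :> R by [].
have h1 : (size S)%:R * (p M - p (M + (M' + X.+1))) <= (size S)%:R * d.
  by rewrite ler_wpM2l // pM // leq_addr.
have h2 : (size S)%:R * (r M' - r (M.+1 + M')) <= (size S)%:R * d.
  by rewrite ler_wpM2l // rM // leq_addl.
have h3 : eps * rho * eps <= p M * r M' * p X.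
  by rewrite !ler_pM ?mulr_ge0 ?(ltW eps0) ?(ltW rho0) ?(ltW (pe _)).
lra.
Qed.

End fastest.

(** * From bullets to particles *)

Section bullets.
Variables (R : realType) (v : nat -> R) (al : nat -> R -> Prop).
Hypothesis v_gt0 : forall k, 0 < v k.+1.
Hypothesis dyn : bullet_dynamics v al.

(* Exchanging the roles of time and space turns the bullet [b_(k+1)] into a
   particle that starts from [k] and has velocity the inverse speed of the bullet. *)
Definition slowness (k : nat) : R := (v k.+1)^-1.
Definition dual_alive (k : nat) (x : R) : Prop :=
  0 <= x /\ al k.+1 (k.+1%:R + x / v k.+1).

Let bullet_posE k x : bullet_pos v k.+1 (k.+1%:R + x / v k.+1) = x.
Proof. by rewrite /bullet_pos addrAC subrr add0r mulrC divfK // gt_eqF. Qed.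

Let timeE k x : k.+1%:R + x / v k.+1 = pos slowness k x + 1.
Proof. by rewrite /pos /slowness -natr1 mulrC addrAC. Qed.

Let timeP k t : k.+1%:R + bullet_pos v k.+1 t / v k.+1 = t.
Proof. by rewrite /bullet_pos mulrC mulKf ?gt_eqF //; lra. Qed.

Lemma clash_collide k j x : clash slowness dual_alive k j x ->
  collide v al k.+1 j.+1 (k.+1%:R + x / v k.+1).
Proof.
move=> [kj [_ ak] [_ aj] E].
have E' : k.+1%:R + x / v k.+1 = j.+1%:R + x / v j.+1 by rewrite !timeE E.
split=> //; [by case|by rewrite E'|by rewrite bullet_posE E' bullet_posE].
Qed.

Lemma collide_clash k j t : collide v al k.+1 j.+1 t ->
  clash slowness dual_alive k j (bullet_pos v k.+1 t).
Proof.
move=> [kj ak aj E].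
have pos_ge0 i : al i.+1 t -> 0 <= bullet_pos v i.+1 t.
  by move=> /dyn[_ it _]; rewrite mulr_ge0 ?subr_ge0 // ltW.
split.
- by move=> e; apply: kj; rewrite e.
- by split; [exact: pos_ge0|rewrite timeP].
- by rewrite E; split; [exact: pos_ge0|rewrite timeP].
- by apply: (addIr 1); rewrite -!timeE timeP E timeP.
Qed.

(** Along one bullet, time and position increase together, so the order of its collisions is the
    same in both pictures. *)
Lemma dual_ballistic : ballistic (fun _ => True) slowness dual_alive.
Proof.
move=> k x; split.
  move=> [x0 /dyn[_ _ H]]; split=> // u j ux C.
  apply: (H _ j.+1 _ (clash_collide C)).
  by rewrite ltrD2l ltr_pM2r ?invr_gt0.
move=> [_ x0 H]; split=> //; apply/dyn; split=> //.
  by rewrite lerDl divr_ge0 // ltW.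
move=> t j tx C; have [_ ak /dyn[j0 _ _] _] := C.
case: j j0 C => // j _ C; apply: (H _ j _ (collide_clash C)).
have : t - k.+1%:R < x / v k.+1 by lra.
by rewrite ltr_pdivlMr // mulrC.
Qed.

(** [b_1] is fired first, so any bullet that collides with it is faster: every annihilation of [b_1]
    is a catch. *)
Lemma survives_dual : b1_survives v al <-> forall x, 0 <= x -> dual_alive 0 x.
Proof.
rewrite /b1_survives /catch_index; split=> [E x x0|H].
  have nc i : ~ catches v al i 1.
    move=> c; have := (ereal_inf_pinfty _).1 E (i%:R)%:E (ex_intro2 _ _ i c erefl).
    by [].
  have [//|nal] := pselect (dual_alive 0 x); exfalso.
  have [u [j [_ C]]] := al_die dual_ballistic (k := 0) I x0 nal.
  have j0 : (0 < j)%N by case: C => ne _ _ _; case: j ne.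
  have := clash_vel dual_ballistic C j0; rewrite /slowness ltf_pV2 ?posrE // => vj.
  apply: (nc j.+1); split=> //; exists (1%:R + u / v 1).
  by have [ne a0 aj e] := clash_collide C; split=> //; exact: nesym.
rewrite (_ : [set _ | _ in _] = set0) ?ereal_inf0 // -subset0 => y [i [i1 vi [t C]] yE].
have [ne ai a1 e] := C; have t1 : 1 <= t by move/dyn: a1 => -[].
have [_ /dyn[_ _ nC]] := H (v 1 * t) ltac:(by rewrite mulr_ge0 ?(ltW (v_gt0 0)) //; lra).
apply: (nC t i); last by split=> //; exact: nesym.
by rewrite mulrC mulKf ?gt_eqF //; lra.
Qed.

End bullets.

(** * The law of the first slownesses *)

Section law.
Variables (R : realType) (n : nat) (s : nat -> R).
Hypotheses (s_pos : 0 < s n)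
  (s_dec : forall k : nat, (1 <= k < n)%N -> s k.+1 < s k).
Variables (d : measure_display) (T : measurableType d) (P : probability T R).
Variables (X : nat -> {RV P >-> R}) (al : T -> nat -> R -> Prop).
Hypothesis hB : bullet_process (speed_set n s) (uniform_law n s) X al.

Lemma speed_lt i j : (0 < i)%N -> (i < j)%N -> (j <= n)%N -> s j < s i.
Proof.
move=> i0; elim: j => [//|j IH]; rewrite ltnS leq_eqVlt => /predU1P[<-|ij] jn.
  by apply: s_dec; rewrite i0.
by apply: lt_trans (IH ij (ltnW jn)); apply: s_dec; lia.
Qed.

Lemma speed_gt0 k : (0 < k)%N -> (k <= n)%N -> 0 < s k.
Proof.
move=> k0; rewrite leq_eqVlt => /predU1P[->//|kn].
exact: lt_trans s_pos (speed_lt k0 kn (leqnn n)).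
Qed.

Definition letters : seq R := mkseq (fun k => (s k.+1)^-1) n.

Lemma lettersP c : reflect (exists2 k, (k < n)%N & c = (s k.+1)^-1) (c \in letters).
Proof.
apply: (iffP mapP) => -[k]; first by rewrite mem_iota; exists k.
by move=> kn ->; exists k; rewrite ?mem_iota.
Qed.

Lemma letters_lt i j : (i < j)%N -> (j < n)%N -> (s i.+1)^-1 < (s j.+1)^-1.
Proof.
move=> ij jn; rewrite ltf_pV2 ?posrE ?speed_gt0 //; last exact: ltn_trans ij jn.
exact: speed_lt.
Qed.

Lemma letters_le i j : (i <= j)%N -> (j < n)%N -> (s i.+1)^-1 <= (s j.+1)^-1.
Proof.
by rewrite leq_eqVlt => /predU1P[->//|ij] jn; exact/ltW/letters_lt.
Qed.

Lemma letters_uniq : uniq letters.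
Proof.
apply/(uniqP 0) => i j; rewrite !inE size_mkseq => iN jN; rewrite !nth_mkseq // => E.
by have [lt|lt|//] := ltngtP i j; [have := letters_lt lt jN|have := letters_lt lt iN];
  rewrite E ltxx.
Qed.

Lemma size_letters : size letters = n.
Proof. exact: size_mkseq. Qed.

Definition word N w : seq R := mkseq (slowness (fun i => X i w)) N.

Lemma X_speed k w : exists2 j, (j < n)%N & X k.+1 w = s j.+1.
Proof.
have [/(_ k.+1 w isT)[j /= j0 <-] _ _ _] := hB.
by exists j.-1; [lia|rewrite prednK //; lia].
Qed.

Lemma X_gt0 k w : 0 < X k.+1 w.
Proof. by have [j jn ->] := X_speed k w; exact: speed_gt0. Qed.

Lemma slowness_letters k w : slowness (fun i => X i w) k \in letters.
Proof. by apply/lettersP; have [j jn E] := X_speed k w; exists j; rewrite // /slowness E. Qed.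

Lemma prob_letter i c : (0 < i)%N -> c \in letters ->
  P (X i @^-1` [set c^-1]) = (n%:R^-1)%:E.
Proof.
move=> i0 /lettersP[k kn ->]; rewrite invrK.
have [_ /(_ i [set s k.+1] i0 (measurable_set1 _)) + _ _] := hB.
rewrite /distribution /pushforward => ->.
rewrite /uniform_law /= /mscale /= /msum (bigD1 (Ordinal kn)) //= big1 ?adde0.
  by rewrite diracE mem_set // mule1.
move=> j /eqP jk; rewrite diracE memNset //= => E; apply: jk; apply/val_inj => /=.
by have [lt|lt|//] := ltngtP j k; [have := letters_lt lt kn|have := letters_lt lt (ltn_ord j)];
  rewrite E ltxx.
Qed.

Lemma cylinder u : {subset u <= letters} ->
  measurable [set w | word (size u) w = u] /\
  P [set w | word (size u) w = u] = (n%:R^-1 ^+ size u)%:E.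
Proof.
move=> uS; pose J := [fset i in iota 1 (size u)]%fset.
pose A i : set R := [set (@nth R 0 u i.-1)^-1].
have JP i : (i \in J) = (0 < i <= size u)%N by rewrite inE /= mem_iota add1n ltnS.
have E : [set w | word (size u) w = u] = \bigcap_(i in [set` J]) (X i @^-1` A i).
  apply/seteqP; split=> w /=.
    move=> wu i /=; rewrite JP => /andP[i0 iu]; rewrite /A /= -wu nth_mkseq; last by rewrite prednK.
    by rewrite /slowness prednK // invrK.
  move=> H; apply: (@eq_from_nth _ 0); rewrite size_mkseq // => i iu.
  rewrite nth_mkseq // /slowness; have := H i.+1; rewrite /= JP => /(_ iu) ->.
  by rewrite /= invrK.
have mA i : measurable (A i) by exact: measurable_set1.
rewrite E; split.
  apply: fin_bigcap_measurable; first exact: finite_fset.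
  by move=> i _; exact: measurable_funPTI.
have [_ _ indep _] := hB.
rewrite (indep J A) //; last by move=> i /=; rewrite JP => /andP[].
rewrite (eq_big_seq (fun=> (n%:R^-1)%:E)) => [|i]; last first.
  rewrite JP => /andP[i0 iu]; apply: prob_letter => //.
  by apply: uS; apply: mem_nth; rewrite prednK.
rewrite prodEFin big_const_seq count_predT iter_mulr_1; congr (_ ^+ _)%:E.
by rewrite -[size _]/(#|` J|)%fset card_fseq undup_id ?iota_uniq // size_iota.
Qed.

(** Induction on the number [N] of free letters, splitting the event according to the next letter;
    the base case is a cylinder or empty. *)
Lemma law_prefix N p (f : seq R -> Prop) : {subset p <= letters} ->
  let E := [set w | word (size p) w = p /\ f (word (size p + N) w)] in
  measurable E /\
  P E = (n%:R^-1 ^+ size p * avg letters N (fun u => ind R (f (p ++ u))))%:E.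
Proof.
elim: N p => [|N IH] p pS E.
  have [mC PC] := cylinder pS; rewrite /= cats0.
  have [fp|nfp] := pselect (f p).
    have -> : E = [set w | word (size p) w = p].
      by rewrite /E addn0; apply/seteqP; split=> w /= [] // wp; split; rewrite ?wp.
    by rewrite (ind_true R fp) mulr1.
  have -> : E = set0.
    by rewrite /E addn0 -subset0 => w /= [->].
  by rewrite (ind_false R nfp) mulr0 measure0.
pose F k := [set w | word (size p).+1 w = rcons p (s k.+1)^-1 /\
  f (word ((size p).+1 + N) w)].
have wordS M w : word M.+1 w = rcons (word M w) (slowness (fun i => X i w) M).
  by rewrite /word mkseqS.
have EF : E = \big[setU/set0]_(k < n) F k.
  rewrite -bigcup_mkord /E; apply/seteqP; split=> w /=.
    move=> [wp fw]; have /lettersP[k kn Ek] := slowness_letters (size p) w.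
    by exists k => //; rewrite /F /= wordS wp Ek addSnnS.
  move=> [k _]; rewrite /F /= wordS addSnnS => -[/eqP]; rewrite eqseq_rcons => /andP[/eqP-> _].
  by split.
have ltnS' (k : 'I_n) : (s k.+1)^-1 \in letters by apply/lettersP; exists k.
have FP (k : 'I_n) : measurable (F k) /\ P (F k) = (n%:R^-1 ^+ (size p).+1 *
    avg letters N (fun u => ind R (f (rcons p (s k.+1)^-1 ++ u))))%:E.
  have := IH (rcons p (s k.+1)^-1); rewrite size_rcons; apply.
  exact/sub_rcons.
rewrite EF; split; first by apply: bigsetU_measurable => k _; exact: (FP k).1.
rewrite measure_bigsetU_ord; first last.
- move=> i j _ _ [w [[wi _] [wj _]]]; apply/val_inj => /=.
  have /eqP : rcons p (s i.+1)^-1 = rcons p (s j.+1)^-1 by rewrite -wi -wj.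
  rewrite eqseq_rcons => /andP[_ /eqP ij].
  by have [lt|lt|//] := ltngtP (i : nat) j; [have := letters_lt lt (ltn_ord j)|
    have := letters_lt lt (ltn_ord i)]; rewrite ij ltxx.
- by move=> k; exact: (FP k).1.
rewrite (eq_bigr (fun k : 'I_n => (n%:R^-1 ^+ (size p).+1 *
    avg letters N (fun u => ind R (f (rcons p (s k.+1)^-1 ++ u))))%:E)); last first.
  by move=> k _; exact: (FP k).2.
rewrite sumEFin -mulr_sumr exprSr -mulrA /= size_letters big_map; congr (_ * (_ * _))%:E.
rewrite (_ : iota 0 n = index_iota 0 n) ?big_mkord; last by rewrite /index_iota subn0.
apply: eq_bigr => k _.
by apply: avg_eq => u _ _; rewrite cat_rcons.
Qed.

Lemma law_word N (f : seq R -> Prop) :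
  measurable [set w | f (word N w)] /\
  P [set w | f (word N w)] = (avg letters N (fun u => ind R (f u)))%:E.
Proof.
have := @law_prefix N [::] f ltac:(by []); rewrite /= add0n expr0 mul1r.
by rewrite (_ : [set w | _ /\ _] = [set w | f (word N w)]) //; by apply/seteqP; split=> w /=; [case|split].
Qed.

End law.

(** * Conditional survival probabilities of [b_1] *)

Section survival_probability.
Variables (R : realType) (n : nat) (s : nat -> R).
Hypotheses (n_gt2 : (2 < n)%N) (s_pos : 0 < s n)
  (s_dec : forall k : nat, (1 <= k < n)%N -> s k.+1 < s k).
Variables (d : measure_display) (T : measurableType d) (P : probability T R).
Variables (X : nat -> {RV P >-> R}) (al : T -> nat -> R -> Prop).
Hypothesis hB : bullet_process (speed_set n s) (uniform_law n s) X al.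

Let S := letters n s.
Let a : R := (s 1)^-1.
Let z : R := (s n)^-1.
Let safe N := safe_time a z N.

Let a_min : {in S, forall c, a <= c}.
Proof. by move=> _ /lettersP[k kn ->]; exact: (letters_le s_pos s_dec (leq0n k) kn). Qed.

Let nE : n = n.-1.+1. Proof. by rewrite prednK //; lia. Qed.

Let z_max : {in S, forall c, c <= z}.
Proof.
move=> _ /lettersP[k kn ->]; rewrite /z nE.
by apply: (letters_le s_pos s_dec); lia.
Qed.

Let in_letters k : (0 < k)%N -> (k <= n)%N -> (s k)^-1 \in S.
Proof. by move=> k0 kn; apply/lettersP; exists k.-1; rewrite ?prednK //; lia. Qed.

Let az : a < z.
Proof. by rewrite /z nE; apply: (letters_lt s_pos s_dec (i := 0)); lia. Qed.

Let dual w := dual_alive (fun i => X i w) (al w).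

Let dualP w : ballistic (fun _ => True) (slowness (fun i => X i w)) (dual w).
Proof.
have [_ _ _ dyn] := hB.
by apply: dual_ballistic (dyn w) => k; exact: (X_gt0 s_pos s_dec hB k w).
Qed.

(** Up to the safe time nothing beyond the first [N.+1] particles can influence the first one, so a
    finite word replaces the infinite process. *)
Let dual_word N w : dual w 0 (safe N) <-> alive (word X N.+1 w) 0 (safe N).
Proof.
have sz : size (word X N.+1 w) = N.+1 by exact: size_mkseq.
apply: (alive_cone (m := a) _ (dualP w)); rewrite ?sz //.
- by exists S => k; exact: (slowness_letters s_pos hB).
- by move=> k kN; split=> //; rewrite /vel nth_mkseq.
- by move=> k _; apply: a_min; exact: (slowness_letters s_pos hB).
- rewrite /pos add0r -natr1.
  have := z_max (slowness_letters s_pos hB 0 w); set c := slowness _ 0 => cz.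
  have za : 0 < z - a by rewrite subr_gt0 az.
  have sN : (z - a) * safe N = N%:R by rewrite mulrC divfK // gt_eqF.
  have sN0 : 0 <= safe N by rewrite divr_ge0 // ltW.
  have : (c - a) * safe N <= (z - a) * safe N by rewrite ler_wpM2r // lerB.
  lra.
Qed.

Section speed.
Variable k : nat.
Hypotheses (k_gt0 : (0 < k)%N) (k_le : (k <= n)%N).
Let c := (s k)^-1.

Let E N := [set w | X 1 w = s k /\ alive (word X N.+1 w) 0 (safe N)].

(** Safe times are unbounded, so survival is a countable intersection of events about finite words;
    this also gives its measurability. *)
Let survivesE : [set w | b1_survives (fun i => X i w) (al w)] `&` [set w | X 1 w = s k]
  = \bigcap_N E N.
Proof.
have za : 0 < z - a by rewrite subr_gt0 az.
have [_ _ _ dyn] := hB.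
have surv w := survives_dual (fun k => X_gt0 s_pos s_dec hB k w) (dyn w).
apply/seteqP; split=> w /=.
  move=> [/surv H Xw] N _; split=> //; apply/dual_word; apply: H.
  by rewrite divr_ge0 // ltW.
move=> H; split; last by have [] := H 0 I.
apply/surv => x x0; pose N := (Num.truncn (x * (z - a))).+1.
have [_ /dual_word aN] := H N I.
apply: al_le (dualP w) _ _ _ aN x0 _.
by rewrite ler_pdivlMr //; exact/ltW/truncnS_gt.
Qed.

Let prob_E N : measurable (E N) /\
  P (E N) = (n%:R^-1 * avg S N (fun u => ind R (alive (c :: u) 0 (safe N))))%:E.
Proof.
pose f v := vel v 0 = c /\ alive v 0 (safe N).
have -> : E N = [set w | f (word X N.+1 w)].
  rewrite /E /f /c; apply/seteqP; split=> w /= [Xw aw]; split=> //.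
    by rewrite /vel /= /slowness Xw.
  by move: Xw; rewrite /vel /= => /invr_inj.
have [mf ->] := law_word s_pos s_dec hB N.+1 f; split=> //; congr _%:E.
rewrite /= size_letters; congr (_ * _); have cS : c \in S by exact: in_letters.
rewrite (bigD1_seq c) //=; last exact: letters_uniq.
rewrite big1_seq ?addr0 => [|e /andP[ec _]].
  by apply: avg_eq => u _ _; apply: ind_iff; rewrite /f; split=> [[]|].
rewrite -[RHS](avg0 S N); apply: avg_eq => u _ _; apply: ind_false => -[].
by rewrite /vel /= => e'; rewrite e' eqxx in ec.
Qed.

Let prob_speed : P [set w | X 1 w = s k] = (n%:R^-1)%:E.
Proof.
by have := prob_letter s_pos s_dec hB (i := 1) isT (in_letters k_gt0 k_le); rewrite invrK.
Qed.

Let n_inv_gt0 : 0 < n%:R^-1 :> R.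
Proof. by rewrite invr_gt0 ltr0n; lia. Qed.

Let m_survives : measurable (\bigcap_N E N).
Proof. by apply: bigcap_measurable => [|N _]; [exists 0|exact: (prob_E N).1]. Qed.

Lemma cond_prob_gt0 delta : 0 < delta ->
  (forall N, delta <= avg S N (fun u => ind R (alive (c :: u) 0 (safe N)))) ->
  0 < cond_prob P [set w | b1_survives (fun i => X i w) (al w)] [set w | X 1 w = s k].
Proof.
move=> delta0 H; rewrite /cond_prob survivesE prob_speed /= divr_gt0 //.
have E_decr : nonincreasing_seq E.
  move=> i j ij; apply/subsetPset => w [Xw /dual_word aw]; split=> //; apply/dual_word.
  have za : 0 < z - a by rewrite subr_gt0 az.
  apply: al_le (dualP w) _ _ _ aw _ _; first by rewrite divr_ge0 // ltW.
  by rewrite ler_pM2r ?invr_gt0 // ler_nat.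
(* Continuity from above carries the uniform lower bound over to the intersection. *)
have cvg := nonincreasing_cvg_mu (mu := P) (le_lt_trans (probability_le1 P (prob_E 0).1) (ltry 1))
  (fun N => (prob_E N).1) m_survives E_decr.
have : ((n%:R^-1 * delta)%:E <= P (\bigcap_N E N))%E.
  apply: (cvge_ge _ cvg); near=> N; rewrite /= (prob_E N).2 lee_fin ler_pM2l //.
have fin : P (\bigcap_N E N) \is a fin_num by exact: fin_num_measure.
rewrite -{1}(fineK fin) lee_fin; apply: lt_le_trans; exact: mulr_gt0.
Unshelve. all: by end_near.
Qed.

Lemma cond_prob_eq0 :
  (forall eps, 0 < eps -> exists N, avg S N (fun u => ind R (alive (c :: u) 0 (safe N))) <= eps) ->
  cond_prob P [set w | b1_survives (fun i => X i w) (al w)] [set w | X 1 w = s k] = 0.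
Proof.
move=> H; rewrite /cond_prob survivesE.
have fin : P (\bigcap_N E N) \is a fin_num by exact: fin_num_measure.
suff -> : fine (P (\bigcap_N E N)) = 0 by rewrite mul0r.
apply/le_anti; rewrite fine_ge0 // andbT; apply/ler_addgt0Pl => eps eps0; rewrite addr0.
have [N HN] := H eps eps0; rewrite -lee_fin fineK //.
have : (P (\bigcap_N E N) <= P (E N))%E.
  by apply: le_measure; rewrite ?inE //; [exact: (prob_E N).1|exact: bigcap_inf].
move=> /le_trans; apply; rewrite (prob_E N).2 lee_fin; apply: le_trans HN.
apply: ler_piMl; first by apply: avg_ge0 => u _ _; exact: ind_ge0.
by rewrite invf_le1 ?ltr0n ?ler1n; lia.
Qed.

End speed.
End survival_probability.

Theorem theorem1 (R : realType) (n : nat) (s : nat -> R)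
    (hn : (3 <= n)%N)
    (hs_pos : 0 < s n)
    (hs_dec : forall k : nat, (1 <= k < n)%N -> s k.+1 < s k)
    (d : measure_display) (T : measurableType d) (P : probability T R)
    (X : nat -> {RV P >-> R}) (alive : T -> nat -> R -> Prop)
    (hB : bullet_process (speed_set n s) (uniform_law n s) X alive) :
  0 < cond_prob P [set w | b1_survives (fun i => X i w) (alive w)]
                  [set w | X 1%N w = s 2%N] /\
  cond_prob P [set w | b1_survives (fun i => X i w) (alive w)]
              [set w | X 1%N w = s n] = 0.
Proof.
have nE : n = n.-1.+1 by rewrite prednK //; lia.
have lt i j := @letters_lt R n s hs_pos hs_dec i j.
have le i j := @letters_le R n s hs_pos hs_dec i j.
have inS k : (0 < k)%N -> (k <= n)%N -> (s k)^-1 \in letters n s.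
  by move=> k0 kn; apply/lettersP; exists k.-1; rewrite ?prednK //; lia.
have a_min : {in letters n s, forall c, (s 1)^-1 <= c}.
  by move=> _ /lettersP[k kn ->]; exact: (le 0 k).
have z_max : {in letters n s, forall c, c <= (s n)^-1}.
  by move=> _ /lettersP[k kn ->]; rewrite nE; apply: le; lia.
have S_uniq := letters_uniq hs_pos hs_dec.
split.
  have b_snd : {in letters n s, forall c, c < (s 2)^-1 -> c = (s 1)^-1}.
    move=> _ /lettersP[[//|k] kn ->]; rewrite ltNge le //; lia.
  have bz : (s 2)^-1 < (s n)^-1 by rewrite nE; apply: (lt 1%N); lia.
  have [delta delta0 H] := second_slowest_survives a_min b_snd z_max S_uniq (inS 1%N isT ltac:(lia))
    (inS 2 isT ltac:(lia)) (inS n ltac:(lia) (leqnn n)) (lt 0 1%N isT ltac:(lia)) bz.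
  apply: (cond_prob_gt0 _ hs_pos hs_dec hB _ _ delta0) => //; try lia.
  move=> N; apply: (le_trans (H N)); apply: avg_le => u _ _; apply: ind_le; apply.
  by rewrite divr_ge0 // subr_ge0 nE; apply: le; lia.
apply: (cond_prob_eq0 _ hs_pos hs_dec hB) => //; try lia.
move=> eps eps0.
have y_snd : {in letters n s, forall c, (s n.-1)^-1 < c -> c = (s n)^-1}.
  move=> _ /lettersP[k kn ->]; rewrite ltNge.
  have [->|kn'] := eqVneq k n.-1; first by rewrite -nE.
  by rewrite (_ : n.-1 = n.-2.+1) ?le //; lia.
(* Since [3 <= n], the index [n.-1] is at least 2, so the second slowest bullet is not the fastest
   one. *)
have ay : (s 1)^-1 < (s n.-1)^-1 by rewrite (_ : n.-1 = n.-2.+1) ?(lt 0) //; lia.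
have yz : (s n.-1)^-1 < (s n)^-1 by rewrite [in ltRHS]nE (_ : n.-1 = n.-2.+1) ?lt //; lia.
have [N HN] := fastest_dies a_min z_max y_snd S_uniq (inS 1%N isT ltac:(lia))
  (inS n.-1 ltac:(lia) ltac:(lia)) (inS n ltac:(lia) (leqnn n)) ay yz eps0.
exists N; apply: le_trans HN; apply: avg_le => u _ uN; by rewrite uN.
Qed.
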